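(* Let $G$ be a game structure (with rational transition probabilities and rational variable interpretations) and $s,t$ states of $G$. For every rational $v$ and every rational $\epsilon>0$ it is decidable whether $|[s\preceq_1 t]-v|<\epsilon$ and whether $|[s\simeq_g t]-v|<\epsilon$. Moreover, it is decidable whether $s\preceq_1 t$ and whether $s\simeq_g t$.
   Context: A game structure $G=(S,[\cdot],\mathit{Moves},\Gamma_1,\Gamma_2,\delta)$: finite state set $S$; finite set $V$ of observation variables, each $v$ interpreted as $[v]:S\to[0,1]$; finite move set; $\Gamma_1,\Gamma_2:S\to2^{\mathit{Moves}}\setminus\{\emptyset\}$; $\delta:S\times\mathit{Moves}\times\mathit{Moves}\to\mathrm{Distr}(S)$. $\bar i=3-i$. Mixed moves $\mathcal{D}_i(s)=\mathrm{Distr}(\Gamma_i(s))$; $\delta(s,x_1,x_2)(u)=\sum_{a_1,a_2}\delta(s,a_1,a_2)(u)x_1(a_1)x_2(a_2)$. Valuations $k:S\to[0,1]$; $\mathrm{E}^{x_1,x_2}_s(k)=\sum_u\delta(s,x_1,x_2)(u)k(u)$; $\mathrm{Pre}_i(k)(s)=\sup_{x_i\in\mathcal{D}_i(s)}\inf_{x_{\bar i}\in\mathcal{D}_{\bar i}(s)}\mathrm{E}^{x_1,x_2}_s(k)$. Directed metrics $d:S\times S\to\mathbb{R}_{\ge0}$ ($d(s,s)=0$, triangle inequality), ordered pointwise; $\breve d(s,t)=d(t,s)$; $\sqcup=\max$; $C(d)=\{k:k(s)-k(t)\le d(s,t)\ \forall s,t\}$; $[s\equiv t]=\max_v|[v](s)-[v](t)|$.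 $H_{\preceq_i}(d)(s,t)=[s\equiv t]\sqcup\sup_{k\in C(d)}(\mathrm{Pre}_i(k)(s)-\mathrm{Pre}_i(k)(t))$. $[\preceq_1]$ is the least fixpoint of $H_{\preceq_1}$; $[\simeq_i]$ is the least fixpoint of $d\mapsto H_{\preceq_i}(d)\sqcup\breve{H_{\preceq_i}(d)}$, and $[\simeq_1]=[\simeq_2]=:[\simeq_g]$. $[s\preceq_1 t]=[\preceq_1](s,t)$, $[s\simeq_g t]=[\simeq_g](s,t)$; the relations $s\preceq_1 t$, $s\simeq_g t$ hold iff the corresponding distance is $0$. *)

(* Defs.v *)
From HB Require Import structures.
From mathcomp Require Import all_boot all_order all_algebra.
From mathcomp Require Import all_classical all_reals.

Set Implicit Arguments.
Unset Strict Implicit.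
Unset Printing Implicit Defensive.

Import Order.TTheory GRing.Theory Num.Theory.
Local Open Scope ring_scope.

(** * Recursive functions

    Kleene's total recursive functions: the least class of number-theoretic
    functions containing zero, successor and projections, and closed under
    composition, primitive recursion and minimization of regular functions
    (those for which a zero always exists).  These are exactly the total
    Turing-computable functions.  A computability model is needed because
    boolean-valued functions of the ambient classical logic are not all
    computable. *)
Inductive recursive : forall n : nat, (n.-tuple nat -> nat) -> Prop :=
| recursive_zero (n : nat) (f : n.-tuple nat -> nat) :
    (forall x, f x = 0%N) -> recursive f
| recursive_succ (f : 1.-tuple nat -> nat) :
    (forall x, f x = (tnth x ord0).+1) -> recursive f
| recursive_proj (n : nat) (i : 'I_n) (f : n.-tuple nat -> nat) :
    (forall x, f x = tnth x i) -> recursive f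
| recursive_comp (n m : nat) (g : m.-tuple nat -> nat)
    (h : 'I_m -> n.-tuple nat -> nat) (f : n.-tuple nat -> nat) :
    recursive g -> (forall i, recursive (h i)) ->
    (forall x, f x = g [tuple h i x | i < m]) -> recursive f
| recursive_prim (n : nat) (g : n.-tuple nat -> nat)
    (h : n.+2.-tuple nat -> nat) (f : n.+1.-tuple nat -> nat) :
    recursive g -> recursive h ->
    (forall x : n.-tuple nat, f [tuple of 0%N :: x] = g x) ->
    (forall (y : nat) (x : n.-tuple nat),
        f [tuple of y.+1 :: x] = h [tuple of y :: f [tuple of y :: x] :: x]) ->
    recursive f
| recursive_mu (n : nat) (g : n.+1.-tuple nat -> nat)
    (f : n.-tuple nat -> nat) :
    recursive g ->
    (forall x : n.-tuple nat, g [tuple of f x :: x] = 0%N) ->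
    (forall (x : n.-tuple nat) (y : nat),
        (y < f x)%N -> g [tuple of y :: x] <> 0%N) ->
    recursive f.

(** [CodeSeq.code] is the library's (effective) bijection [seq nat -> nat]. *)
Definition decidable_problem (I : Type) (code : I -> seq nat)
    (P : I -> Prop) : Prop :=
  exists2 f : 1.-tuple nat -> nat, recursive f &
    forall q : I, (P q -> f [tuple CodeSeq.code (code q)] = 1%N) /\
                  (~ P q -> f [tuple CodeSeq.code (code q)] = 0%N).

(** * Game structures *)

Inductive player := player1 | player2.

Definition opponent (i : player) : player :=
  if i is player1 then player2 else player1.

Definition is_distr (F : realFieldType) (T : finType) (x : T -> F) : Prop :=
  (forall a, 0 <= x a) /\ \sum_a x a = 1.

Definition is_distr_on (F : realFieldType) (T : finType) (A : {set T})
    (x : T -> F) : Prop :=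
  is_distr x /\ (forall a, a \notin A -> x a = 0).

(** The field of scalars is a parameter, so that game structures with rational
    data are the elements of [game_structure rat]. *)
Record game_structure (F : realFieldType) := GameStructure {
  state : finType;
  obs_var : finType;
  move : finType;
  obs : obs_var -> state -> F;
  avail : player -> state -> {set move};
  delta : state -> move -> move -> state -> F;
  obs_itv : forall v s, 0 <= obs v s <= 1;
  avail_neq0 : forall i s, avail i s != finset.set0;
  delta_distr : forall s a1 a2, is_distr (delta s a1 a2)
}.

Arguments avail {F} g i s.
Arguments obs {F} g v s.
Arguments delta {F} g s a1 a2 u.

Section Embedding.
Variables (R : realType) (G : game_structure rat).

Lemma obs_itv_ratr (v : obs_var G) (s : state G) :
  0 <= (ratr (obs G v s) : R) <= 1.
Proof. by rewrite ler0q -[1 in X in _ && X](rmorph1 (@ratr R)) ler_rat obs_itv. Qed.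

Lemma delta_distr_ratr (s : state G) (a1 a2 : move G) :
  is_distr (fun u => ratr (delta G s a1 a2 u) : R).
Proof.
have [d_ge0 d_sum] := delta_distr s a1 a2.
split=> [u|]; first by rewrite ler0q.
by rewrite -rmorph_sum /= d_sum rmorph1.
Qed.

Definition real_game : game_structure R :=
  @GameStructure R (state G) (obs_var G) (move G)
    (fun v s => ratr (obs G v s)) (avail G)
    (fun s a1 a2 u => ratr (delta G s a1 a2 u))
    obs_itv_ratr (@avail_neq0 _ G) delta_distr_ratr.

End Embedding.

(** * Game metrics *)

Local Open Scope classical_set_scope.

Section Metrics.
Variables (R : realType) (G : game_structure R).

Implicit Types (s t u : state G) (k : state G -> R)
  (d : state G -> state G -> R) (x y : move G -> R) (i : player).

Definition valuation k : Prop := forall s, 0 <= k s <= 1.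

Definition mixed_move i s : set (move G -> R) :=
  [set x | is_distr_on (avail G i s) x].

Definition delta_mixed s x1 x2 u : R :=
  \sum_(a1 : move G) \sum_(a2 : move G) delta G s a1 a2 u * x1 a1 * x2 a2.

Definition expect s x1 x2 k : R := \sum_(u : state G) delta_mixed s x1 x2 u * k u.

(** [x] is the mixed move of player [i], [y] the one of the opponent. *)
Definition expect_for i s x y k : R :=
  if i is player1 then expect s x y k else expect s y x k.

Definition Pre i k s : R :=
  sup [set inf [set expect_for i s x y k | y in mixed_move (opponent i) s]
      | x in mixed_move i s].

Definition directed_metric d : Prop :=
  [/\ forall s t, 0 <= d s t,
      forall s, d s s = 0
    & forall s t u, d s u <= d s t + d t u].

Definition converse d : state G -> state G -> R := fun s t => d t s.

Definition metric_join d d' : state G -> state G -> R :=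
  fun s t => Num.max (d s t) (d' s t).

Definition Lip d : set (state G -> R) :=
  [set k | valuation k /\ forall s t, k s - k t <= d s t].

Definition obs_dist s t : R :=
  \big[Num.max/0]_(v : obs_var G) `|obs G v s - obs G v t|.

Definition Hsim i d : state G -> state G -> R :=
  fun s t => Num.max (obs_dist s t) (sup [set Pre i k s - Pre i k t | k in Lip d]).

Definition Hbisim i d : state G -> state G -> R :=
  metric_join (Hsim i d) (converse (Hsim i d)).

Definition least_fixpoint
    (H : (state G -> state G -> R) -> state G -> state G -> R) d : Prop :=
  [/\ directed_metric d,
      forall s t, H d s t = d s t
    & forall d', directed_metric d' -> (forall s t, H d' s t = d' s t) ->
        forall s t, d s t <= d' s t].

(** Definite description: a least fixpoint is unique, and it exists for the
    monotone operators used below. *)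
Definition lfp (H : (state G -> state G -> R) -> state G -> state G -> R) :
    state G -> state G -> R :=
  xget (fun _ _ => 0) (least_fixpoint H).

Definition sim_dist i : state G -> state G -> R := lfp (Hsim i).

Definition bisim_dist i : state G -> state G -> R := lfp (Hbisim i).

(** The distances [bisim_dist player1] and [bisim_dist player2] coincide. *)
Definition game_bisim_dist : state G -> state G -> R := bisim_dist player1.

Definition sim i s t : Prop := sim_dist i s t = 0.

Definition game_bisim s t : Prop := game_bisim_dist s t = 0.

End Metrics.

(** * Problem instances and their encoding as sequences of numbers *)

Record instance := Instance {
  inst_game : game_structure rat;
  inst_s : state inst_game;
  inst_t : state inst_game
}.

Record approx_instance := ApproxInstance {
  approx_inst : instance;
  approx_val : rat;
  approx_eps : rat;
  approx_eps_gt0 : 0 < approx_eps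
}.

Definition code_int (z : int) : nat :=
  match z with Posz n => n.*2 | Negz n => n.*2.+1 end.

Definition code_rat (q : rat) : seq nat := [:: code_int (numq q); `|denq q|%N].

(** Finite types are presented by their cardinals and their elements by their
    ranks; tables are listed in lexicographic order of their arguments. *)
Definition code_game (G : game_structure rat) : seq nat :=
  [:: #|state G|; #|obs_var G|; #|move G|] ++
  flatten [seq code_rat (obs G v s) | v <- enum (obs_var G), s <- enum (state G)] ++
  [seq nat_of_bool (a \in avail G player1 s)
     | s <- enum (state G), a <- enum (move G)] ++
  [seq nat_of_bool (a \in avail G player2 s)
     | s <- enum (state G), a <- enum (move G)] ++
  flatten [seq flatten [seq code_rat (delta G s a.1 a.2 u)
     | a <- [seq (a1, a2) | a1 <- enum (move G), a2 <- enum (move G)],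
       u <- enum (state G)] | s <- enum (state G)].

Definition code_instance (q : instance) : seq nat :=
  [:: nat_of_ord (enum_rank (inst_s q)); nat_of_ord (enum_rank (inst_t q))] ++
  code_game (inst_game q).

Definition code_approx_instance (q : approx_instance) : seq nat :=
  code_rat (approx_val q) ++ code_rat (approx_eps q) ++
  code_instance (approx_inst q).

(* Main.v *)
Require Import Defs.
From HB Require Import structures.
From mathcomp Require Import all_boot all_order all_algebra.
From mathcomp Require Import all_classical all_reals.
From mathcomp Require Import polyrcf.
From mathcomp Require Import zify ring lra.

Set Implicit Arguments.
Unset Strict Implicit.
Unset Printing Implicit Defensive.

Import Order.TTheory GRing.Theory Num.Theory.

(** The distances are least fixpoints, hence least prefixpoints, of monotone operators, and
    every value of these operators is a directed metric. Being a prefixpoint is a first-order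
    property of the finitely many reals [d s t] in the ordered field of reals: [Pre] is
    compared with a number through mixed moves of player 1 and pure replies of player 2. So
    [dist s t <= c] and [dist s t < c] are first-order sentences with rational coefficients,
    and both the approximation problems and the zero problems are Boolean combinations of
    such sentences.

    Sentences are decided by the Cohen-Hoermander quantifier elimination. A family of
    polynomials in one variable is closed under derivatives, truncations and
    pseudo-remainders; once the signs of all coefficients are fixed, the table of signs of
    the family along the line is computed by adding the polynomials in the order of their
    degrees: at a root of a smaller polynomial the sign of the new one is that of a
    remainder, and between two consecutive points it is monotone, since the sign of its
    derivative is known. To eliminate a quantifier, all sign assignments of the coefficients
    are enumerated.

    Recursiveness is carried through the bijection of pairs with positive numbers
    [(n, m) |-> 2 ^ n * (2 m + 1)], which is also the one behind [CodeSeq.code]: every number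
    is then either [0] or a pair of smaller numbers, so lists and expressions are handled by
    primitive recursion on their codes. *)

(** * Recursive functions of one, two and three arguments *)

(** Iterating the operators from the zero metric bounds the distances from below only and would
    never certify that one of them is zero; prefixpoints supply the upper bounds. The price is the
    quantifier pattern [exists d, forall k w x, exists y] over a matrix that multiplies mixed moves
    by valuations, so linear arithmetic is not enough and full real quantifier elimination is called
    for.

    Since the ambient logic is classical, a Boolean function carries no computability by itself:
    each function of the algorithm needs a recursive realizer on codes. This shapes the programs.
    They are built from folds, maps and bounded iterations on pairs, lists and expressions, so that
    a syntax-directed tactic can assemble the realizers. It also favours an elimination method that
    only manipulates lists of coefficients and signs, without isolating roots. *)

Definition rec1 (f : nat -> nat) : Prop :=
  recursive (fun t : 1.-tuple nat => f (tnth t ord0)).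

Definition rec2 (f : nat -> nat -> nat) : Prop :=
  recursive (fun t : 2.-tuple nat => f (tnth t ord0) (tnth t (lift ord0 ord0))).

Definition rec3 (f : nat -> nat -> nat -> nat) : Prop :=
  recursive (fun t : 3.-tuple nat =>
    f (tnth t ord0) (tnth t (lift ord0 ord0)) (tnth t (lift ord0 (lift ord0 ord0)))).

(** Every constructor specifies its function only pointwise, so composing [f] with all the
    projections reaches any [g] that agrees with it. *)
Lemma recursive_ext n (f g : n.-tuple nat -> nat) :
  recursive f -> f =1 g -> recursive g.
Proof.
move=> rf fg; apply: (recursive_comp (h := fun i (x : n.-tuple nat) => tnth x i) rf).
  by move=> i; apply: (@recursive_proj _ i).
move=> x; rewrite -fg; congr f; apply: eq_from_tnth => i.
by rewrite tnth_mktuple.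
Qed.

Lemma recursive_app1 n (g : nat -> nat) (f : n.-tuple nat -> nat) :
  rec1 g -> recursive f -> recursive (fun t => g (f t)).
Proof.
move=> rg rf; apply: (recursive_comp (h := fun _ => f) rg) => // x.
by rewrite tnth_mktuple.
Qed.

Lemma recursive_app2 n (g : nat -> nat -> nat) (f1 f2 : n.-tuple nat -> nat) :
  rec2 g -> recursive f1 -> recursive f2 -> recursive (fun t => g (f1 t) (f2 t)).
Proof.
move=> rg r1 r2.
apply: (recursive_comp (h := fun i => if i == ord0 then f1 else f2) rg).
  by move=> i; case: ifP.
by move=> x; rewrite !tnth_mktuple.
Qed.

Lemma recursive_const n c : recursive (fun _ : n.-tuple nat => c).
Proof.
elim: c => [|c IHc]; first exact: recursive_zero.
have rS : rec1 succn by exact: recursive_succ.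
exact: (recursive_app1 rS IHc).
Qed.

Lemma rec1_ext f g : rec1 f -> f =1 g -> rec1 g.
Proof. by move=> rf fg; apply: (recursive_ext rf) => t. Qed.

Lemma rec2_ext f g : rec2 f -> f =2 g -> rec2 g.
Proof. by move=> rf fg; apply: (recursive_ext rf) => t. Qed.

Lemma rec1_id : rec1 id.
Proof. exact: recursive_proj. Qed.

Lemma rec1_succ : rec1 succn.
Proof. exact: recursive_succ. Qed.

Lemma rec1_const c : rec1 (fun _ => c).
Proof. exact: recursive_const. Qed.

Lemma rec2_fst : rec2 (fun x _ => x).
Proof. exact: recursive_proj. Qed.

Lemma rec2_snd : rec2 (fun _ y => y).
Proof. exact: recursive_proj. Qed.

Lemma rec1_comp f g : rec1 f -> rec1 g -> rec1 (fun x => f (g x)).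
Proof. exact: recursive_app1. Qed.

Lemma rec1_app2 F f g : rec2 F -> rec1 f -> rec1 g -> rec1 (fun x => F (f x) (g x)).
Proof. exact: recursive_app2. Qed.

Lemma rec2_app1 F f : rec1 F -> rec2 f -> rec2 (fun x y => F (f x y)).
Proof. exact: recursive_app1. Qed.

Lemma rec2_app2 F f g : rec2 F -> rec2 f -> rec2 g ->
  rec2 (fun x y => F (f x y) (g x y)).
Proof. exact: recursive_app2. Qed.

Lemma rec3_proj1 : rec3 (fun x _ _ => x). Proof. exact: recursive_proj. Qed.
Lemma rec3_proj2 : rec3 (fun _ x _ => x). Proof. exact: recursive_proj. Qed.
Lemma rec3_proj3 : rec3 (fun _ _ x => x). Proof. exact: recursive_proj. Qed.

Lemma rec3_app1 F f : rec1 F -> rec3 f -> rec3 (fun x y z => F (f x y z)).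
Proof. exact: recursive_app1. Qed.

Lemma rec3_app2 F f g : rec2 F -> rec3 f -> rec3 g ->
  rec3 (fun x y z => F (f x y z) (g x y z)).
Proof. exact: recursive_app2. Qed.

Definition natrec (A : Type) (z : A) (f : nat -> A -> A) (n : nat) : A :=
  nat_rect (fun _ => A) z f n.

Lemma rec2_natrec g h : rec1 g -> rec3 h ->
  rec2 (fun n x => natrec (g x) (fun i r => h i r x) n).
Proof.
move=> rg rh; apply: (recursive_prim rg rh).
  by move=> x; rewrite !(tnth_nth 0).
by move=> y x; rewrite !(tnth_nth 0).
Qed.

Lemma rec2_add : rec2 addn.
Proof.
have r := rec2_natrec rec1_id (rec3_app1 rec1_succ rec3_proj2).
apply: (rec2_ext r) => n x; elim: n => //= n ->.
by rewrite addSn.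
Qed.

Lemma rec2_mul : rec2 muln.
Proof.
have r := rec2_natrec (rec1_const 0) (rec3_app2 rec2_add rec3_proj3 rec3_proj2).
by apply: (rec2_ext r) => n x; elim: n => //= n ->; rewrite mulSn.
Qed.

Lemma rec2_swap f : rec2 f -> rec2 (fun x y => f y x).
Proof. by move=> rf; apply: rec2_app2 rf rec2_snd rec2_fst. Qed.

Lemma rec2_exp : rec2 expn.
Proof.
have r := rec2_natrec (rec1_const 1) (rec3_app2 rec2_mul rec3_proj3 rec3_proj2).
apply: rec2_swap; apply: (rec2_ext r) => n x.
elim: n => // n IHn.
exact: etrans (congr1 (muln x) IHn) (esym (expnS x n)).
Qed.

Lemma rec1_pred : rec1 predn.
Proof.
have r := rec2_natrec (rec1_const 0) rec3_proj1.
by apply: (rec1_ext (rec1_app2 r rec1_id rec1_id)) => -[].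
Qed.

Lemma rec2_sub : rec2 subn.
Proof.
have r := rec2_natrec rec1_id (rec3_app1 rec1_pred rec3_proj2).
apply: rec2_swap; apply: (rec2_ext r) => n x.
elim: n => [|n IHn]; first exact: esym (subn0 x).
exact: etrans (congr1 predn IHn) (esym (subnS x n)).
Qed.

Lemma rec2_leq : rec2 (fun x y => x <= y).
Proof.
apply: (rec2_ext (rec2_app2 rec2_sub (rec2_app1 (rec1_const 1) rec2_fst) rec2_sub)).
by move=> x y; rewrite /leq; case: (x - y).
Qed.

Lemma rec2_eq : rec2 (fun x y => x == y).
Proof.
apply: (rec2_ext (rec2_app2 rec2_mul rec2_leq (rec2_swap rec2_leq))).
by move=> x y; rewrite eqn_leq mulnb.
Qed.

Lemma rec2_div : rec2 divn.
Proof.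
(* The quotient is the least [q] with [x < q.+1 * d]; the factor [d] makes the test vanish at once
   when [d = 0], in accordance with [x %/ 0 = 0]. *)
pose test q x d := (q.+1 * d <= x) * d.
have rtest : rec3 test.
  apply: rec3_app2 rec2_mul _ rec3_proj3.
  apply: rec3_app2 rec2_leq _ rec3_proj2.
  by apply: rec3_app2 rec2_mul _ rec3_proj3; apply: rec3_app1 rec1_succ rec3_proj1.
apply: (recursive_mu rtest) => [t|t y]; rewrite !(tnth_nth 0) /= /test.
  set x := nth 0 t 0; set d := nth 0 t 1; case: (posnP d) => [->|d0]; first by rewrite muln0.
  by rewrite leqNgt ltn_ceil.
set x := nth 0 t 0; set d := nth 0 t 1; case: (posnP d) => [->|d0]; first by rewrite divn0.
by rewrite leq_divRL // => ->; rewrite mul1n; case: d d0.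
Qed.

Lemma rec2_mod : rec2 modn.
Proof.
apply: (rec2_ext (rec2_app2 rec2_sub rec2_fst
         (rec2_app2 rec2_mul rec2_div rec2_snd))) => x d.
by rewrite {1}(divn_eq x d) addKn.
Qed.

(** * Pairing *)

Definition pcons (n m : nat) : nat := 2 ^ n * m.*2.+1.
Definition pcar (x : nat) : nat := logn 2 x.
Definition pcdr (x : nat) : nat := x %/ 2 ^ (pcar x).+1.

Lemma pcons_gt0 n m : 0 < pcons n m.
Proof. by rewrite muln_gt0 expn_gt0. Qed.

Lemma pcar_cons n m : pcar (pcons n m) = n.
Proof.
rewrite /pcar /pcons lognM ?expn_gt0 // pfactorK // lognE /= dvdn2 /= odd_double.
by rewrite addn0.
Qed.

Lemma pcdr_cons n m : pcdr (pcons n m) = m.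
Proof.
rewrite /pcdr pcar_cons /pcons expnSr divnMA mulKn ?expn_gt0 //.
by rewrite divn2 /= uphalf_double.
Qed.

Lemma ltn_pcons1 n m : n < pcons n m.
Proof. by rewrite /pcons (leq_trans (ltn_expl n (ltnSn 1))) // leq_pmulr. Qed.

Lemma ltn_pcons2 n m : m < pcons n m.
Proof.
by rewrite /pcons (@leq_trans m.*2.+1) ?ltnS ?leq_pmull ?expn_gt0 // -addnn leq_addr.
Qed.

Lemma pcons_inj n m n' m' : pcons n m = pcons n' m' -> n = n' /\ m = m'.
Proof.
move=> e; split; first by rewrite -(pcar_cons n m) e pcar_cons.
by rewrite -(pcdr_cons n m) e pcdr_cons.
Qed.

Lemma rec2_pcons : rec2 pcons.
Proof.
apply: rec2_app2 rec2_mul _ _.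
  exact: rec2_app2 rec2_exp (rec2_app1 (rec1_const 2) rec2_fst) rec2_fst.
apply: rec2_app1 rec1_succ _.
apply: (rec2_ext (rec2_app2 rec2_add rec2_snd rec2_snd)) => x y.
exact: addnn.
Qed.

Lemma rec1_pcar : rec1 pcar.
Proof.
(* The valuation is the least [n] such that [2 ^ n.+1] does not divide [x]; the factor [x] stops the
   search at 0 when [x = 0], as [logn 2 0 = 0]. *)
pose test n x := x * (x %% 2 ^ n.+1 == 0).
have rtest : rec2 test.
  apply: rec2_app2 rec2_mul rec2_snd _.
  apply: rec2_app2 rec2_eq _ (rec2_app1 (rec1_const 0) rec2_fst).
  apply: rec2_app2 rec2_mod rec2_snd _.
  exact: rec2_app2 rec2_exp (rec2_app1 (rec1_const 2) rec2_fst) (rec2_app1 rec1_succ rec2_fst).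
apply: (recursive_mu rtest) => [t|t y]; rewrite !(tnth_nth 0) /= /test /pcar.
  set x := nth 0 t 0; case: (posnP x) => [->|x0]; first by rewrite mul0n.
  by rewrite -/(dvdn _ _) pfactor_dvdn // ltnn muln0.
set x := nth 0 t 0; case: (posnP x) => [->|x0]; first by rewrite logn0.
by rewrite -/(dvdn _ _) pfactor_dvdn // => ->; rewrite muln1; case: x x0.
Qed.

Lemma rec1_pcdr : rec1 pcdr.
Proof.
apply: rec1_app2 rec2_div rec1_id _.
apply: rec1_app2 rec2_exp (rec1_const 2) _.
exact: rec1_comp rec1_succ rec1_pcar.
Qed.

Lemma rec1_natrec n g h : rec1 n -> rec1 g -> rec1 h ->
  rec1 (fun x => natrec (g x) (fun i r => h (pcons i (pcons r x))) (n x)).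
Proof.
move=> rn rg rh.
have rh3 : rec3 (fun i r x => h (pcons i (pcons r x))).
  apply: rec3_app1 rh _; apply: rec3_app2 rec2_pcons rec3_proj1 _.
  exact: rec3_app2 rec2_pcons rec3_proj2 rec3_proj3.
exact: (rec1_app2 (rec2_natrec rg rh3) rn rec1_id).
Qed.

Lemma rec1_if b f g : rec1 (fun x => nat_of_bool (b x)) -> rec1 f -> rec1 g ->
  rec1 (fun x => if b x then f x else g x).
Proof.
move=> rb rf rg.
have r1 := rec1_app2 rec2_mul rb rf.
have r2 := rec1_app2 rec2_mul (rec1_app2 rec2_sub (rec1_const 1) rb) rg.
apply: (rec1_ext (rec1_app2 rec2_add r1 r2)) => x /=.
by case: (b x); rewrite ?mul1n ?mul0n ?addn0 ?add0n.
Qed.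

(** * Computable functions between encoded types *)

(** Injectivity reduces equality of data to equality of codes ([eq_op_computable]). *)
Class Enc (T : Type) := { enc : T -> nat; enc_inj : injective enc }.

#[export] Instance Enc_nat : Enc nat := {| enc := id; enc_inj := @inj_id nat |}.

Lemma nat_of_bool_inj : injective nat_of_bool.
Proof. by do 2 case. Qed.

#[export] Instance Enc_bool : Enc bool :=
  {| enc := nat_of_bool; enc_inj := nat_of_bool_inj |}.

Lemma enc_prod_inj A B (EA : Enc A) (EB : Enc B) :
  injective (fun p : A * B => pcons (enc p.1) (enc p.2)).
Proof. by case=> a b [a' b'] /= /pcons_inj [ea eb]; rewrite (enc_inj ea) (enc_inj eb). Qed.

#[export] Instance Enc_prod A B (EA : Enc A) (EB : Enc B) : Enc (A * B) :=
  {| enc := fun p => pcons (enc p.1) (enc p.2); enc_inj := @enc_prod_inj A B EA EB |}.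

Definition enc_list A (EA : Enc A) : seq A -> nat :=
  foldr (fun x n => pcons (enc x) n) 0.

Lemma enc_list_inj A (EA : Enc A) : injective (@enc_list A EA).
Proof.
elim=> [|x s IHs] [|y t] //=.
- by move/esym/eqP; rewrite (gtn_eqF (pcons_gt0 _ _)).
- by move/eqP; rewrite (gtn_eqF (pcons_gt0 _ _)).
by case/pcons_inj => ex /IHs ->; rewrite (enc_inj ex).
Qed.

#[export] Instance Enc_seq A (EA : Enc A) : Enc (seq A) :=
  {| enc := @enc_list A EA; enc_inj := @enc_list_inj A EA |}.

(** The realizer [g] is constrained on codes only and may return anything on other numbers. *)
Definition computable A B {EA : Enc A} {EB : Enc B} (f : A -> B) : Prop :=
  exists2 g, rec1 g & forall a, g (enc a) = enc (f a).

(** One class per arity, with the arguments packed in nested pairs: instance search can then find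
    the computability of a named function that occurs inside a larger term. *)
Class Computable1 A B {EA : Enc A} {EB : Enc B} (F : A -> B) : Prop :=
  computable1 : computable F.

Class Computable2 A B C {EA : Enc A} {EB : Enc B} {EC : Enc C} (F : A -> B -> C) : Prop :=
  computable2 : computable (fun p : A * B => F p.1 p.2).

Class Computable3 A B C D {EA : Enc A} {EB : Enc B} {EC : Enc C} {ED : Enc D}
    (F : A -> B -> C -> D) : Prop :=
  computable3 : computable (fun p : A * (B * C) => F p.1 p.2.1 p.2.2).

Class Computable4 A B C D E {EA : Enc A} {EB : Enc B} {EC : Enc C} {ED : Enc D} {EE : Enc E}
    (F : A -> B -> C -> D -> E) : Prop :=
  computable4 : computable (fun p : A * (B * (C * D)) => F p.1 p.2.1 p.2.2.1 p.2.2.2).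

Section BasicCombinators.
Context {A B C : Type} {EA : Enc A} {EB : Enc B} {EC : Enc C}.

Lemma computable_ext (f g : A -> B) : f =1 g -> computable f -> computable g.
Proof. by move=> fg [h rh hE]; exists h => // a; rewrite hE fg. Qed.

Lemma computable_id : computable (fun a : A => a).
Proof. by exists id => //; exact: rec1_id. Qed.

Lemma computable_const (b : B) : computable (fun _ : A => b).
Proof. by exists (fun _ => enc b) => //; exact: rec1_const. Qed.

Lemma computable_comp (g : B -> C) (f : A -> B) :
  computable g -> computable f -> computable (fun a => g (f a)).
Proof.
move=> [g' rg gE] [f' rf fE]; exists (fun x => g' (f' x)); first exact: rec1_comp.
by move=> a; rewrite fE gE.
Qed.

Lemma computable_pair (f : A -> B) (g : A -> C) :
  computable f -> computable g -> computable (fun a => (f a, g a)).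
Proof.
move=> [f' rf fE] [g' rg gE]; exists (fun x => pcons (f' x) (g' x)).
  exact: rec1_app2 rec2_pcons rf rg.
by move=> a; rewrite fE gE.
Qed.

Lemma computable_fst (f : A -> B * C) : computable f -> computable (fun a => (f a).1).
Proof.
move=> [g rg gE]; exists (fun x => pcar (g x)); first exact: rec1_comp rec1_pcar rg.
by move=> a; rewrite gE pcar_cons.
Qed.

Lemma computable_snd (f : A -> B * C) : computable f -> computable (fun a => (f a).2).
Proof.
move=> [g rg gE]; exists (fun x => pcdr (g x)); first exact: rec1_comp rec1_pcdr rg.
by move=> a; rewrite gE pcdr_cons.
Qed.

Lemma computable_if (b : A -> bool) (f g : A -> B) : computable b -> computable f ->
  computable g -> computable (fun a => if b a then f a else g a).
Proof.
move=> [b' rb bE] [f' rf fE] [g' rg gE].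
exists (fun x => if b' x == 1 then f' x else g' x).
  by apply: rec1_if => //; exact: rec1_app2 rec2_eq rb (rec1_const 1).
by move=> a; rewrite bE fE gE; case: (b a).
Qed.

(** The code of [x :: s] is that of the pair [(x, s)] and is never 0, the code of [[::]]; hence the
    code of the list is passed unchanged to the realizer of [f]. *)
Lemma computable_lcase (l : A -> seq B) (f : A -> B -> seq B -> C) (g : A -> C) :
  computable l -> computable (fun p : A * (B * seq B) => f p.1 p.2.1 p.2.2) -> computable g ->
  computable (fun a => if l a is x :: s then f a x s else g a).
Proof.
move=> [l' rl lE] [f' rf fE] [g' rg gE].
exists (fun x => if l' x == 0 then g' x else f' (pcons x (l' x))).
  apply: rec1_if => //; first exact: rec1_app2 rec2_eq rl (rec1_const 0).
  by apply: rec1_comp rf _; apply: rec1_app2 rec2_pcons rec1_id rl.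
move=> a; rewrite lE; case: (l a) => [|x s] /=; first exact: gE.
by rewrite -(fE (a, (x, s))) /= gtn_eqF // pcons_gt0.
Qed.

Lemma computable_natrec (n : A -> nat) (z : A -> B) (h : A -> nat -> B -> B) :
  computable (fun p : A * (nat * B) => h p.1 p.2.1 p.2.2) -> computable n -> computable z ->
  computable (fun a => natrec (z a) (h a) (n a)).
Proof.
move=> [h' rh hE] [n' rn nE] [z' rz zE].
pose H x := h' (pcons (pcdr (pcdr x)) (pcons (pcar x) (pcar (pcdr x)))).
have rH : rec1 H.
  have rdd := rec1_comp rec1_pcdr rec1_pcdr; have rad := rec1_comp rec1_pcar rec1_pcdr.
  apply: rec1_comp rh _; apply: rec1_app2 rec2_pcons rdd _.
  exact: rec1_app2 rec2_pcons rec1_pcar rad.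
exists (fun x => natrec (z' x) (fun i r => H (pcons i (pcons r x))) (n' x)).
  exact: rec1_natrec.
move=> a; rewrite nE /=; elim: (n a) => [|k IHk]; first exact: zE.
rewrite /natrec /= -/(natrec _ _ _) IHk /H !(pcdr_cons, pcar_cons).
exact: (hE (a, (k, natrec (z a) (h a) k))).
Qed.

End BasicCombinators.

Section Applications.
Context {A B C D E X : Type} {EA : Enc A} {EB : Enc B} {EC : Enc C} {ED : Enc D} {EE : Enc E}
  {EX : Enc X}.

Lemma computable_app1 (F : B -> C) {cF : Computable1 F} (f : A -> B) :
  computable f -> computable (fun a => F (f a)).
Proof. exact: computable_comp cF. Qed.

Lemma computable_app2 (F : B -> C -> D) {cF : Computable2 F} (f : A -> B) (g : A -> C) :
  computable f -> computable g -> computable (fun a => F (f a) (g a)).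
Proof. by move=> cf cg; apply: (computable_comp cF (computable_pair cf cg)). Qed.

Lemma computable_app3 (F : B -> C -> D -> E) {cF : Computable3 F}
    (f : A -> B) (g : A -> C) (h : A -> D) :
  computable f -> computable g -> computable h -> computable (fun a => F (f a) (g a) (h a)).
Proof.
move=> cf cg ch.
exact: (computable_comp cF (computable_pair cf (computable_pair cg ch))).
Qed.

Lemma computable_app4 (F : B -> C -> D -> E -> X) {cF : Computable4 F}
    (f : A -> B) (g : A -> C) (h : A -> D) (k : A -> E) :
  computable f -> computable g -> computable h -> computable k ->
  computable (fun a => F (f a) (g a) (h a) (k a)).
Proof.
move=> cf cg ch ck.
exact: (computable_comp cF
  (computable_pair cf (computable_pair cg (computable_pair ch ck)))).
Qed.

End Applications.

(** * Syntax-directed proofs of computability *)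

Ltac computable_binder := simple eapply computable_natrec.
(** The instance is resolved before [refine]: an application with constant arguments also matches a
    pattern of smaller arity, and the failing search makes [match] try the next one. *)
Ltac computable_app :=
  match goal with
  | H : computable ?f |- computable (fun a => ?f (@?k a)) =>
      refine (@computable_comp _ _ _ _ _ _ f k H _)
  | |- computable ?F => exact (_ : Computable1 F)
  | |- computable (fun a => ?F (@?f a)) =>
      let c := constr:(_ : Computable1 F) in
      refine (@computable_app1 _ _ _ _ _ _ F c f _)
  | |- computable (fun a => ?F (@?f a) (@?g a)) =>
      let c := constr:(_ : Computable2 F) in
      refine (@computable_app2 _ _ _ _ _ _ _ _ F c f g _ _)
  | |- computable (fun a => ?F (@?f a) (@?g a) (@?h a)) =>
      let c := constr:(_ : Computable3 F) in
      refine (@computable_app3 _ _ _ _ _ _ _ _ _ _ F c f g h _ _ _)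
  | |- computable (fun a => ?F (@?f a) (@?g a) (@?h a) (@?k a)) =>
      let c := constr:(_ : Computable4 F) in
      refine (@computable_app4 _ _ _ _ _ _ _ _ _ _ _ _ F c f g h k _ _ _ _)
  end.
Ltac computable_step :=
  first [ assumption | simple eapply computable_const | simple eapply computable_id
        | simple eapply computable_pair | simple eapply computable_fst
        | simple eapply computable_snd | simple eapply computable_if
        | simple eapply computable_lcase | computable_binder | computable_app
        | match goal with H : _ |- computable _ => simple eapply H end ].
Ltac computability :=
  rewrite /Computable1 /Computable2 /Computable3 /Computable4;
  solve [unshelve (repeat computable_step); exact _].

Lemma rec1_computable F : rec1 F -> Computable1 F.
Proof. by move=> rF; exists F. Qed.

Lemma rec2_computable F : rec2 F -> Computable2 F.
Proof.
move=> rF; exists (fun x => F (pcar x) (pcdr x)); first exact: rec1_app2 rF rec1_pcar rec1_pcdr.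
by move=> [x y]; rewrite pcar_cons pcdr_cons.
Qed.

#[export] Instance succn_computable : Computable1 succn := rec1_computable rec1_succ.
#[export] Instance predn_computable : Computable1 predn := rec1_computable rec1_pred.
#[export] Instance pcar_computable : Computable1 pcar := rec1_computable rec1_pcar.
#[export] Instance pcdr_computable : Computable1 pcdr := rec1_computable rec1_pcdr.
#[export] Instance addn_computable : Computable2 addn := rec2_computable rec2_add.
#[export] Instance muln_computable : Computable2 muln := rec2_computable rec2_mul.
#[export] Instance subn_computable : Computable2 subn := rec2_computable rec2_sub.
#[export] Instance divn_computable : Computable2 divn := rec2_computable rec2_div.
#[export] Instance modn_computable : Computable2 modn := rec2_computable rec2_mod.
#[export] Instance pcons_computable : Computable2 pcons := rec2_computable rec2_pcons.

#[export] Instance leq_computable : Computable2 leq.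
Proof. by have [h rh hE] := rec2_computable rec2_leq; exists h. Qed.

#[export] Instance enc_computable A {EA : Enc A} : Computable1 (enc : A -> nat).
Proof. by exists id => //; exact: rec1_id. Qed.

#[export] Instance eq_op_computable (T : eqType) {ET : Enc T} : Computable2 (@eq_op T).
Proof.
exists (fun x => pcar x == pcdr x); first exact: rec1_app2 rec2_eq rec1_pcar rec1_pcdr.
by move=> [x y]; rewrite pcar_cons pcdr_cons (inj_eq enc_inj).
Qed.

#[export] Instance cons_computable A {EA : Enc A} : Computable2 (@cons A).
Proof. by exists id => //; exact: rec1_id. Qed.

#[export] Instance negb_computable : Computable1 negb.
Proof. by rewrite /negb; computability. Qed.

#[export] Instance andb_computable : Computable2 andb.
Proof. by rewrite /andb; computability. Qed.

#[export] Instance maxn_computable : Computable2 maxn.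
Proof. by rewrite /maxn; computability. Qed.

Lemma computable_iter A B {EA : Enc A} {EB : Enc B} (n : A -> nat) (z : A -> B) (h : A -> B -> B) :
  computable (fun p : A * B => h p.1 p.2) -> computable n -> computable z ->
  computable (fun a => iter (n a) (h a) (z a)).
Proof.
move=> ch cn cz.
apply: (@computable_ext _ _ _ _ (fun a => natrec (z a) (fun _ r => h a r) (n a))).
  by move=> a; elim: (n a) => //= k ->.
apply: computable_natrec => //.
by apply: (computable_comp (f := fun p : A * (nat * B) => (p.1, p.2.2)) ch); computability.
Qed.

(** This hook collects the lemmas for operations with a function argument that may depend on the
    input; instances of a fixed arity do not cover these. *)
Ltac computable_binder ::= first [simple eapply computable_natrec | simple eapply computable_iter].

#[export] Instance behead_computable A {EA : Enc A} : Computable1 (@behead A).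
Proof. by rewrite /behead; computability. Qed.

#[export] Instance drop_computable A {EA : Enc A} : Computable2 (@drop A).
Proof.
apply: (@computable_ext _ _ _ _ (fun p => iter p.1 behead p.2)); last computability.
by case=> n s /=; elim: n s => [|k IHk] s; rewrite ?drop0 // iterSr IHk; case: s.
Qed.

(** Recursion over a list needs a computable bound on its length before [size] itself is available;
    the code is such a bound. *)
Lemma size_le_enc A {EA : Enc A} (s : seq A) : size s <= enc s.
Proof. by elim: s => //= x s IHs; apply: leq_ltn_trans IHs _; apply: ltn_pcons2. Qed.

(* The fold is run from the right end: [i] steps have folded [drop (enc l - i) l]. *)
Lemma computable_foldr A B C {EA : Enc A} {EB : Enc B} {EC : Enc C}
    (h : A -> B -> C -> C) (z : A -> C) (l : A -> seq B) :
  computable (fun p : A * (B * C) => h p.1 p.2.1 p.2.2) -> computable z -> computable l ->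
  computable (fun a => foldr (h a) (z a) (l a)).
Proof.
move=> ch cz cl.
apply: (@computable_ext _ _ _ _ (fun a => natrec (z a) (fun i r =>
  if drop (enc (l a) - i.+1) (l a) is x :: s then h a x r else z a) (enc (l a)))).
  move=> a; set n := enc _.
  suff H i : i <= n -> natrec (z a) (fun i r =>
      if drop (n - i.+1) (l a) is x :: s then h a x r else z a) i =
      foldr (h a) (z a) (drop (n - i) (l a)) by rewrite H // subnn drop0.
  elim: i => [_|i IHi ltin]; first by rewrite subn0 drop_oversize ?size_le_enc.
  rewrite /natrec /= -/(natrec _ _ _) IHi 1?ltnW //.
  have -> : n - i = (n - i.+1).+1 by lia.
  set k := n - i.+1; rewrite -addn1 addnC -drop_drop.
  by case: (drop k (l a)) => //= x s; rewrite drop0.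
apply: computable_natrec => //; apply: computable_lcase; [computability| |computability].
by apply: (computable_comp (f := fun p : A * (nat * C) * (B * seq B) =>
    (p.1.1, (p.2.1, p.1.2.2))) ch); computability.
Qed.

Ltac computable_binder ::= first [simple eapply computable_natrec
  | simple eapply computable_iter | simple eapply computable_foldr].

#[export] Instance size_computable A {EA : Enc A} : Computable1 (@size A).
Proof.
apply: (@computable_ext _ _ _ _ (foldr (fun _ n => n.+1) 0)); last computability.
by elim=> //= x s ->.
Qed.

#[export] Instance head_computable A {EA : Enc A} : Computable2 (@head A).
Proof. by rewrite /head; computability. Qed.

#[export] Instance nth_computable A {EA : Enc A} : Computable3 (@nth A).
Proof.
apply: (@computable_ext _ _ _ _ (fun p => head p.1 (drop p.2.2 p.2.1))); last computability.
by move=> [x [s i]]; rewrite -nth0 nth_drop addn0.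
Qed.

#[export] Instance cat_computable A {EA : Enc A} : Computable2 (@cat A).
Proof.
apply: (@computable_ext _ _ _ _ (fun p => foldr cons p.2 p.1)); last computability.
by case=> s t /=; elim: s => //= x s ->.
Qed.

#[export] Instance flatten_computable A {EA : Enc A} : Computable1 (@flatten A).
Proof. by rewrite /flatten; computability. Qed.

#[export] Instance iota_computable : Computable1 (iota 0).
Proof.
apply: (@computable_ext _ _ _ _ (natrec [::] (fun i r => r ++ [:: i]))); last computability.
elim=> // k IHk; transitivity (iota 0 k ++ [:: k]); first by rewrite -IHk.
by rewrite -[k.+1]addn1 iotaD.
Qed.

#[export] Instance nseq_computable A {EA : Enc A} : Computable2 (@nseq A).
Proof.
apply: (@computable_ext _ _ _ _ (fun p => iter p.1 (cons p.2) [::])); last computability.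
by case=> n x /=; elim: n => //= k ->.
Qed.

Section ListBinders.
Context {A B C : Type} {EA : Enc A} {EB : Enc B} {EC : Enc C}.

Lemma computable_map (h : A -> B -> C) (l : A -> seq B) :
  computable (fun p : A * B => h p.1 p.2) -> computable l ->
  computable (fun a => map (h a) (l a)).
Proof.
(* Read as a [Computable2] instance, the hypothesis becomes visible to the instance search of
   [computability]. *)
move=> ch cl; have ch2 : Computable2 h := ch.
apply: (@computable_ext _ _ _ _ (fun a => foldr (fun x s => h a x :: s) [::] (l a))).
  by move=> a; elim: (l a) => //= x s ->.
by computability.
Qed.

Lemma computable_filter (h : A -> B -> bool) (l : A -> seq B) :
  computable (fun p : A * B => h p.1 p.2) -> computable l ->
  computable (fun a => seq.filter (h a) (l a)).
Proof.
move=> ch cl; have ch2 : Computable2 h := ch.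
apply: (@computable_ext _ _ _ _
  (fun a => foldr (fun x s => if h a x then x :: s else s) [::] (l a))).
  by move=> a; elim: (l a) => //= x s ->.
by computability.
Qed.

Lemma computable_has (h : A -> B -> bool) (l : A -> seq B) :
  computable (fun p : A * B => h p.1 p.2) -> computable l ->
  computable (fun a => has (h a) (l a)).
Proof.
move=> ch cl; have ch2 : Computable2 h := ch.
apply: (@computable_ext _ _ _ _
  (fun a => foldr (fun x s => if h a x then true else s) false (l a))).
  by move=> a; elim: (l a) => //= x s ->.
by computability.
Qed.

Lemma computable_all (h : A -> B -> bool) (l : A -> seq B) :
  computable (fun p : A * B => h p.1 p.2) -> computable l ->
  computable (fun a => all (h a) (l a)).
Proof.
move=> ch cl; have ch2 : Computable2 h := ch.
apply: (@computable_ext _ _ _ _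
  (fun a => foldr (fun x s => if h a x then s else false) true (l a))).
  by move=> a; elim: (l a) => //= x s ->.
by computability.
Qed.

End ListBinders.

Lemma enc_seq_nat (s : seq nat) : enc s = CodeSeq.code s.
Proof. by []. Qed.

Lemma computable_decidable (I : Type) (code : I -> seq nat) (P : I -> Prop) (b : seq nat -> bool) :
  computable b -> (forall q, P q <-> b (code q)) -> decidable_problem code P.
Proof.
move=> [g rg gE] Pb; exists (fun t => g (tnth t ord0)) => // q.
rewrite (tnth_nth 0) /= -enc_seq_nat gE; split; first by move/Pb => ->.
by move=> nP; case: (b _) (Pb q) => // -[_ h]; case: nP; exact: h.
Qed.

(** * Polynomial expressions *)

(* [Cst p m q] stands for the rational number [(p - m) / q]. *)
Inductive expr :=
| Var of nat
| Cst of nat & nat & nat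
| Add of expr & expr
| Mul of expr & expr.

Fixpoint enc_expr (e : expr) : nat :=
  match e with
  | Var n => pcons 0 n
  | Cst p m q => pcons 1 (pcons p (pcons m q))
  | Add a b => pcons 2 (pcons (enc_expr a) (enc_expr b))
  | Mul a b => pcons 3 (pcons (enc_expr a) (enc_expr b))
  end.

Lemma enc_expr_inj : injective enc_expr.
Proof.
elim=> [n|p m q|a IHa b IHb|a IHa b IHb] [n'|p' m' q'|a' b'|a' b'] /= /pcons_inj [] //.
- by move=> _ ->.
- by move=> _ /pcons_inj [-> /pcons_inj [-> ->]].
- by move=> _ /pcons_inj [/IHa -> /IHb ->].
- by move=> _ /pcons_inj [/IHa -> /IHb ->].
Qed.

#[export] Instance Enc_expr : Enc expr := {| enc := enc_expr; enc_inj := enc_expr_inj |}.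

HB.instance Definition _ := Equality.copy expr (inj_type enc_expr_inj).

(** [eval], [abstr] and [value0] are all instances of this fold, so recursion on the codes of
    expressions is justified only once. *)
Fixpoint efold (B : Type) (fv : nat -> B) (fc : nat -> nat -> nat -> B)
    (fa fm : B -> B -> B) (e : expr) : B :=
  match e with
  | Var n => fv n
  | Cst p m q => fc p m q
  | Add a b => fa (efold fv fc fa fm a) (efold fv fc fa fm b)
  | Mul a b => fm (efold fv fc fa fm a) (efold fv fc fa fm b)
  end.

#[export] Instance Var_computable : Computable1 Var.
Proof.
have [k rk kE] : computable (fun n => pcons 0 n) by computability.
by exists k.
Qed.

#[export] Instance Cst_computable : Computable3 Cst.
Proof.
have [k rk kE] : computable (fun x : nat * (nat * nat) =>
  pcons 1 (pcons x.1 (pcons x.2.1 x.2.2))) by computability.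
by exists k.
Qed.

#[export] Instance Add_computable : Computable2 Add.
Proof.
have [k rk kE] : computable (fun x : expr * expr => pcons 2 (pcons (enc x.1) (enc x.2))).
  by computability.
by exists k.
Qed.

#[export] Instance Mul_computable : Computable2 Mul.
Proof.
have [k rk kE] : computable (fun x : expr * expr => pcons 3 (pcons (enc x.1) (enc x.2))).
  by computability.
by exists k.
Qed.

(* Course-of-values recursion on the codes of expressions. *)
Lemma computable_efold A B {EA : Enc A} {EB : Enc B}
    (fv : A -> nat -> B) (fc : A -> nat -> nat -> nat -> B)
    (fa fm : A -> B -> B -> B) (e : A -> expr) :
  computable (fun p : A * nat => fv p.1 p.2) ->
  computable (fun p : A * (nat * (nat * nat)) => fc p.1 p.2.1 p.2.2.1 p.2.2.2) ->
  computable (fun p : A * (B * B) => fa p.1 p.2.1 p.2.2) ->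
  computable (fun p : A * (B * B) => fm p.1 p.2.1 p.2.2) -> computable e ->
  computable (fun a => efold (fv a) (fc a) (fa a) (fm a) (e a)).
Proof.
move=> cv cc ca cm ce.
have cv2 : Computable2 fv := cv; have cc4 : Computable4 fc := cc.
have ca3 : Computable3 fa := ca; have cm3 : Computable3 fm := cm.
(* [tab a n] lists the values at [n - 1], ..., [0], newest first, so the value at [j] has index
   [n - j.+1]. *)
pose look a (n : nat) (t : seq B) j := nth (fv a 0) t (n - j.+1).
have clook : Computable4 look by rewrite /look; computability.
pose v a n t :=
  if pcar n == 0 then fv a (pcdr n) else
  if pcar n == 1 then fc a (pcar (pcdr n)) (pcar (pcdr (pcdr n))) (pcdr (pcdr (pcdr n))) else
  if pcar n == 2 then fa a (look a n t (pcar (pcdr n))) (look a n t (pcdr (pcdr n))) else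
  fm a (look a n t (pcar (pcdr n))) (look a n t (pcdr (pcdr n))).
have cvv : Computable3 v by rewrite /v; computability.
pose tab a := natrec [::] (fun n t => v a n t :: t).
have ctab : Computable2 tab by rewrite /tab; computability.
apply: (@computable_ext _ _ _ _ (fun a => v a (enc (e a)) (tab a (enc (e a))))); last computability.
move=> a; pose w n := v a n (tab a n).
have lookE n j : j < n -> look a n (tab a n) j = w j.
  rewrite /look; elim: n => // n IHn; rewrite ltnS leq_eqVlt => /orP[/eqP ->|ltjn].
    by rewrite subnn.
  by have -> : n.+1 - j.+1 = (n - j.+1).+1; [lia|exact: IHn].
rewrite -/(w _); elim: (e a) => [n|p m q|x IHx y IHy|x IHx y IHy] /=;
  rewrite {1}/w /v /= !(pcar_cons, pcdr_cons) //=.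
- by rewrite !lookE ?IHx ?IHy //; apply: ltn_trans (ltn_pcons2 _ _);
     rewrite ?ltn_pcons1 ?ltn_pcons2.
- by rewrite !lookE ?IHx ?IHy //; apply: ltn_trans (ltn_pcons2 _ _);
     rewrite ?ltn_pcons1 ?ltn_pcons2.
Qed.

Ltac computable_binder ::= first [simple eapply computable_natrec
  | simple eapply computable_iter | simple eapply computable_foldr | simple eapply computable_map
  | simple eapply computable_filter | simple eapply computable_has
  | simple eapply computable_all | simple eapply computable_efold].

(** * Polynomials with expressions as coefficients *)

Definition zeroE : expr := Cst 0 0 1.
Definition oneE : expr := Cst 1 0 1.
Definition oppE (e : expr) : expr := Mul (Cst 0 1 1) e.

(** Coefficients are listed from the lowest degree and never simplified. The length therefore only
    bounds the degree, which depends on the values of the other variables. *)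
Definition padd (p q : seq expr) : seq expr :=
  [seq Add (nth zeroE p i) (nth zeroE q i) | i <- iota 0 (maxn (size p) (size q))].
Definition pscale (c : expr) (p : seq expr) : seq expr := [seq Mul c a | a <- p].
Definition pmul (p q : seq expr) : seq expr :=
  foldr (fun c r => padd (pscale c q) (zeroE :: r)) [::] p.
Definition pderiv (p : seq expr) : seq expr :=
  [seq Mul (Cst i.+1 0 1) (nth zeroE p i.+1) | i <- iota 0 (size p).-1].
Definition ptrunc (p : seq expr) : seq expr :=
  [seq nth zeroE p i | i <- iota 0 (size p).-1].
Definition plead (p : seq expr) : expr := nth zeroE p (size p).-1.

(* One step of pseudo-division by [q], multiplying [p] by the square of the
   leading coefficient of [q], so that the sign of [p] is kept at the roots of [q]. *)
Definition prem_step (q p : seq expr) : seq expr :=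
  if (0 < size q) && (size q <= size p) then
    padd (pscale (Mul (plead q) (plead q)) (ptrunc p))
      (nseq (size p - size q) zeroE ++
       pscale (oppE (Mul (plead p) (plead q))) (ptrunc q))
  else p.
(** [size p] rounds suffice: an effective step shortens the list by exactly one, because the leading
    terms are deleted instead of being left to cancel, and a list shorter than [q] stays fixed. *)
Definition prem (p q : seq expr) : seq expr := iter (size p) (prem_step q) p.

(** The coefficients are free of [v], so changing the value of [v] only moves the point of
    evaluation ([horner_abstr]). *)
Definition abstr (v : nat) (e : expr) : seq expr :=
  efold (fun n => if n == v then [:: zeroE; oneE] else [:: Var n])
    (fun p m q => [:: Cst p m q]) padd pmul e.

#[export] Instance padd_computable : Computable2 padd.
Proof. by rewrite /padd; computability. Qed.

#[export] Instance pscale_computable : Computable2 pscale.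
Proof. by rewrite /pscale; computability. Qed.

#[export] Instance pmul_computable : Computable2 pmul.
Proof. by rewrite /pmul; computability. Qed.

#[export] Instance pderiv_computable : Computable1 pderiv.
Proof. by rewrite /pderiv; computability. Qed.

#[export] Instance ptrunc_computable : Computable1 ptrunc.
Proof. by rewrite /ptrunc; computability. Qed.

#[export] Instance plead_computable : Computable1 plead.
Proof. by rewrite /plead; computability. Qed.

#[export] Instance prem_computable : Computable2 prem.
Proof. by rewrite /prem /prem_step /oppE; computability. Qed.

#[export] Instance abstr_computable : Computable2 abstr.
Proof. by rewrite /abstr; computability. Qed.

(** * Sign tables *)

(* Signs are numbers: 0 for zero, 1 for positive, 2 for negative. *)
Definition flip (s : nat) : nat := if s == 0 then 0 else 3 - s.

(* An expression that is not listed gets the sign 0. *)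
Definition lookup (s : seq (expr * nat)) (e : expr) : nat :=
  foldr (fun x r => if x.1 == e then x.2 else r) 0 s.

(** Strips the top coefficients that the assignment [S] declares zero, so that formal and actual
    degree agree. *)
Definition norm (S : seq (expr * nat)) (p : seq expr) : seq expr :=
  foldr (fun c r => if (size r == 0) && (lookup S c == 0) then [::] else c :: r) [::] p.

(** Truncations are there for [norm], which replaces a polynomial by a prefix; which prefix depends
    on the signs of the coefficients. *)
Definition cstep (F : seq (seq expr)) : seq (seq expr) :=
  F ++ [seq pderiv p | p <- F] ++ [seq ptrunc p | p <- F] ++
  flatten [seq [seq prem p q | q <- F] | p <- F].
Definition msize (F : seq (seq expr)) : nat := foldr (fun p n => maxn (size p) n) 0 F.
Definition close (E : seq (seq expr)) : seq (seq expr) := iter (msize E) cstep E.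

(* A column lists the signs of some polynomials on a point or an open interval.
   A table [(c, [:: (p1, c1); (p2, c2); ...])] describes the line from left to
   right: the interval [c], the point [p1], the interval [c1], ... *)
Notation column := (seq (seq expr * nat)).
Notation table := (column * seq (column * column))%type.

(** The empty list, that is the zero polynomial, is never entered in a table and gets the sign 0
    directly. *)
Definition csign (c : column) (p : seq expr) : nat :=
  if size p == 0 then 0 else foldr (fun x r => if x.1 == p then x.2 else r) 0 c.
Definition zero_of (c : column) : seq expr :=
  foldr (fun x r => if (x.2 == 0) && (1 < size x.1) then x.1 else r) [::] c.
Definition psign (S : seq (expr * nat)) (c : column) (P : seq expr) : nat :=
  csign c (norm S (prem P (zero_of c))).
(** On an interval where [P] is strictly monotone the signs [sl] and [sr] at the ends decide
    everything: opposite nonzero signs force exactly one root, and otherwise the sign is constant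
    and equal to that of a nonvanishing end. *)
Definition split_col (sl : nat) (c : column) (P : seq expr) (sr : nat) : table :=
  if (sl != 0) && ((sr != 0) && (sl != sr)) then
    ((P, sl) :: c, [:: ((P, 0) :: c, (P, sr) :: c)])
  else ((P, if sl == 0 then sr else sl) :: c, [::]).
(** The fold runs from the right and hands to each interval the sign of [P] at its right end. It
    starts with the sign at plus infinity, that of the leading coefficient. *)
Definition refine_fold (S : seq (expr * nat)) (P : seq expr) (T : seq (column * column)) :
    nat * seq (column * column) :=
  foldr (fun x r => (psign S x.1 P,
     ((P, psign S x.1 P) :: x.1, (split_col (psign S x.1 P) x.2 P r.1).1) ::
      (split_col (psign S x.1 P) x.2 P r.1).2 ++ r.2)) (lookup S (plead P), [::]) T.
(** The size exceeds the degree by one, so odd size means even degree. *)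
Definition sign_minfty (S : seq (expr * nat)) (P : seq expr) : nat :=
  if size P %% 2 == 1 then lookup S (plead P) else flip (lookup S (plead P)).
Definition refine_const (s : nat) (P : seq expr) (T : table) : table :=
  ((P, s) :: T.1, [seq ((P, s) :: x.1, (P, s) :: x.2) | x <- T.2]).
Definition refine (S : seq (expr * nat)) (P : seq expr) (T : table) : table :=
  if size P <= 1 then refine_const (lookup S (plead P)) P T
  else ((split_col (sign_minfty S P) T.1 P (refine_fold S P T.2).1).1,
        (split_col (sign_minfty S P) T.1 P (refine_fold S P T.2).1).2 ++
        (refine_fold S P T.2).2).
(** Sizes decrease along the list and [foldr] starts at its end, so the smallest polynomials enter
    the table first. *)
Definition by_size (S : seq (expr * nat)) (F : seq (seq expr)) : nat -> seq (seq expr) :=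
  natrec [::] (fun n r => [seq p <- [seq norm S p | p <- F] | size p == n.+1] ++ r).
Definition sign_table (S : seq (expr * nat)) (F : seq (seq expr)) : table :=
  foldr (refine S) ([::], [::]) (by_size S F (msize F)).
Definition columns (T : table) : seq column :=
  T.1 :: flatten [seq [:: x.1; x.2] | x <- T.2].

(** * Quantifier elimination on disjunctions of sign conditions *)

Notation dnf := (seq (seq (expr * nat))).

(** A retained assignment is itself a conjunction of sign conditions in the result, so one that no
    valuation realizes contributes an unsatisfiable disjunct and does no harm. *)
Definition assignments (l : seq expr) : seq (seq (expr * nat)) :=
  foldr (fun e r => flatten [seq [seq (e, s) :: a | a <- r] | s <- [:: 0; 1; 2]]) [:: [::]] l.
Definition dnf_exprs (D : dnf) : seq expr := [seq x.1 | x <- flatten D].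
Definition dnf_eval (f : expr -> nat) (D : dnf) : bool :=
  has (fun c => all (fun x => f x.1 == x.2) c) D.

Definition qe_or (D D' : dnf) : dnf := D ++ D'.
Definition qe_and (D D' : dnf) : dnf := flatten [seq [seq c ++ c' | c' <- D'] | c <- D].
Definition qe_not (D : dnf) : dnf :=
  [seq s <- assignments (dnf_exprs D) | ~~ dnf_eval (lookup s) D].
Definition qe_ex (v : nat) (D : dnf) : dnf :=
  [seq s <- assignments (flatten (close [seq abstr v e | e <- dnf_exprs D])) |
    has (fun c => dnf_eval (fun e => csign c (norm s (abstr v e))) D)
      (columns (sign_table s (close [seq abstr v e | e <- dnf_exprs D])))].

#[export] Instance lookup_computable : Computable2 lookup.
Proof. by rewrite /lookup; computability. Qed.

#[export] Instance norm_computable : Computable2 norm.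
Proof. by rewrite /norm; computability. Qed.

#[export] Instance msize_computable : Computable1 msize.
Proof. by rewrite /msize; computability. Qed.

#[export] Instance close_computable : Computable1 close.
Proof. by rewrite /close /cstep; computability. Qed.

#[export] Instance csign_computable : Computable2 csign.
Proof. by rewrite /csign; computability. Qed.

#[export] Instance zero_of_computable : Computable1 zero_of.
Proof. by rewrite /zero_of; computability. Qed.

#[export] Instance psign_computable : Computable3 psign.
Proof. by rewrite /psign; computability. Qed.

#[export] Instance split_col_computable : Computable4 split_col.
Proof. by rewrite /split_col; computability. Qed.

#[export] Instance refine_fold_computable : Computable3 refine_fold.
Proof. by rewrite /refine_fold; computability. Qed.

#[export] Instance refine_computable : Computable3 refine.
Proof. by rewrite /refine /refine_const /sign_minfty /flip; computability. Qed.

#[export] Instance sign_table_computable : Computable2 sign_table.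
Proof. by rewrite /sign_table /by_size; computability. Qed.

#[export] Instance columns_computable : Computable1 columns.
Proof. by rewrite /columns; computability. Qed.

#[export] Instance assignments_computable : Computable1 assignments.
Proof. by rewrite /assignments; computability. Qed.

#[export] Instance dnf_exprs_computable : Computable1 dnf_exprs.
Proof. by rewrite /dnf_exprs; computability. Qed.

#[export] Instance qe_or_computable : Computable2 qe_or.
Proof. by rewrite /qe_or; computability. Qed.

#[export] Instance qe_and_computable : Computable2 qe_and.
Proof. by rewrite /qe_and; computability. Qed.

#[export] Instance qe_not_computable : Computable1 qe_not.
Proof. by rewrite /qe_not /dnf_eval; computability. Qed.

#[export] Instance qe_ex_computable : Computable2 qe_ex.
Proof. by rewrite /qe_ex /dnf_eval; computability. Qed.

Local Open Scope ring_scope.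

(** * Evaluation of expressions and of polynomials with expression coefficients *)

Section Eval.
Variable R : rcfType.
Implicit Types (rho : nat -> R) (x y : R) (p q : seq expr).

Definition eval rho (e : expr) : R :=
  efold rho (fun a b c => (a%:R - b%:R) / c%:R) +%R *%R e.

Definition upd rho (v : nat) x : nat -> R := fun n => if n == v then x else rho n.

Definition sgn x : nat := if x == 0 then 0%N else if 0 < x then 1%N else 2%N.

Definition pol rho p : {poly R} := Poly [seq eval rho c | c <- p].

Lemma sgn_eq0 x : (sgn x == 0%N) = (x == 0).
Proof. by rewrite /sgn; case: (x == 0); case: (0 < x). Qed.

Lemma sgn_pos x : 0 < x -> sgn x = 1%N.
Proof. by move=> x0; rewrite /sgn gt_eqF // x0. Qed.

Lemma sgn_neg x : x < 0 -> sgn x = 2%N.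
Proof. by move=> x0; rewrite /sgn lt_eqF // lt_gtF. Qed.

Lemma sgn0 : sgn 0 = 0%N.
Proof. by rewrite /sgn eqxx. Qed.

Lemma sgnP x : [\/ x = 0 /\ sgn x = 0%N, 0 < x /\ sgn x = 1%N | x < 0 /\ sgn x = 2%N].
Proof.
case: (ltgtP x 0) => [x0|x0|->].
- by apply: Or33; rewrite sgn_neg.
- by apply: Or32; rewrite sgn_pos.
- by apply: Or31; rewrite sgn0.
Qed.

Lemma sgnN x : sgn (- x) = flip (sgn x).
Proof.
case: (sgnP x) => -[h ->]; first by rewrite h oppr0 sgn0.
  by rewrite sgn_neg ?oppr_lt0.
by rewrite sgn_pos ?oppr_gt0.
Qed.

Lemma sgn_pmul a x : 0 < a -> sgn (a * x) = sgn x.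
Proof.
move=> a0; case: (sgnP x) => -[h ->]; first by rewrite h mulr0 sgn0.
  by rewrite sgn_pos // mulr_gt0.
by rewrite sgn_neg // pmulr_rlt0.
Qed.

Lemma sgn_in x : sgn x \in [:: 0; 1; 2]%N.
Proof. by case: (sgnP x) => -[_ ->]. Qed.

Lemma flip_eq0 s : (s < 3)%N -> (flip s == 0%N) = (s == 0%N).
Proof. by case: s => [|[|[|]]]. Qed.

Lemma eval_zeroE rho : eval rho zeroE = 0.
Proof. by rewrite /eval /= subrr mul0r. Qed.

Lemma eval_oneE rho : eval rho oneE = 1.
Proof. by rewrite /eval /= subr0 divr1. Qed.

Lemma eval_oppE rho e : eval rho (oppE e) = - eval rho e.
Proof. by rewrite /eval /= sub0r divr1 mulN1r. Qed.

Lemma evalD rho a b : eval rho (Add a b) = eval rho a + eval rho b.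
Proof. by []. Qed.

Lemma evalM rho a b : eval rho (Mul a b) = eval rho a * eval rho b.
Proof. by []. Qed.

Lemma coef_pol rho p i : (pol rho p)`_i = eval rho (nth zeroE p i).
Proof.
rewrite coef_Poly; case: (ltnP i (size p)) => lt_ip; first by rewrite (nth_map zeroE).
by rewrite !nth_default ?size_map // eval_zeroE.
Qed.

Lemma coef_pol_map rho (f : nat -> expr) n i :
  (pol rho [seq f j | j <- iota 0 n])`_i = if (i < n)%N then eval rho (f i) else 0.
Proof.
rewrite coef_pol; case: ltnP => lt_in; last first.
  by rewrite nth_default ?size_map ?size_iota // eval_zeroE.
by rewrite (nth_map 0%N) ?size_iota // nth_iota.
Qed.

Lemma pol_padd rho p q : pol rho (padd p q) = pol rho p + pol rho q.
Proof.
apply/polyP => i; rewrite coef_pol_map coefD !coef_pol; case: ltnP => //.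
rewrite geq_max => /andP[hp hq].
by rewrite !nth_default // eval_zeroE addr0.
Qed.

Lemma pol_pscale rho c p : pol rho (pscale c p) = eval rho c *: pol rho p.
Proof.
apply/polyP => i; rewrite coefZ !coef_pol; case: (ltnP i (size p)) => lt_ip.
  by rewrite (nth_map zeroE).
by rewrite !nth_default ?size_map // eval_zeroE mulr0.
Qed.

Lemma pol_cons rho c p : pol rho (c :: p) = pol rho p * 'X + (eval rho c)%:P.
Proof. by rewrite /pol /= cons_poly_def. Qed.

Lemma pol_nil rho : pol rho [::] = 0. Proof. by []. Qed.

Lemma pol_pmul rho p q : pol rho (pmul p q) = pol rho p * pol rho q.
Proof.
elim: p => [|c p IHp]; first by rewrite pol_nil mul0r.
rewrite /= pol_padd pol_pscale !pol_cons IHp eval_zeroE addr0 -mul_polyC.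
by rewrite mulrDl addrC -!mulrA ['X * _]mulrC.
Qed.

Lemma pol_pderiv rho p : pol rho (pderiv p) = (pol rho p)^`().
Proof.
apply/polyP => i; rewrite coef_pol_map coef_deriv coef_pol.
case: ltnP => lt_ip; first by rewrite /eval /= subr0 divr1 mulr_natl.
by rewrite nth_default ?eval_zeroE ?mul0rn //; case: (size p) lt_ip.
Qed.

Lemma ptruncE p : ptrunc p = take (size p).-1 p.
Proof.
apply: (@eq_from_nth _ zeroE) => [|i].
  by rewrite size_map size_iota size_take; case: (size p) => //= n; rewrite ltnSn.
rewrite size_map size_iota => lt_ip.
by rewrite (nth_map 0%N) ?size_iota // nth_iota // nth_take.
Qed.

Lemma horner_trunc rho p x : (0 < size p)%N ->
  (pol rho p).[x] = (pol rho (ptrunc p)).[x] + eval rho (plead p) * x ^+ (size p).-1.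
Proof.
move=> p0; have -> : pol rho p = pol rho (ptrunc p) + eval rho (plead p) *: 'X^((size p).-1).
  apply/polyP => i; rewrite coefD coefZ coefXn coef_pol coef_pol_map.
  case: (ltngtP i (size p).-1) => [lt_ip|gt_ip|->] /=.
  - by rewrite mulr0 addr0.
  - by rewrite nth_default ?eval_zeroE ?mulr0 ?addr0 //; case: (size p) p0 gt_ip.
  - by rewrite mulr1 add0r.
by rewrite hornerD hornerZ hornerXn.
Qed.

Lemma horner_shift rho n p x : (pol rho (nseq n zeroE ++ p)).[x] = x ^+ n * (pol rho p).[x].
Proof.
elim: n => [|n IHn]; first by rewrite mul1r.
by rewrite /= pol_cons hornerD hornerMX hornerC IHn eval_zeroE addr0 exprSr mulrAC.
Qed.

Lemma size_pscale c p : size (pscale c p) = size p. Proof. exact: size_map. Qed.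

Lemma size_padd p q : size (padd p q) = maxn (size p) (size q).
Proof. by rewrite size_map size_iota. Qed.

Lemma size_ptrunc p : size (ptrunc p) = (size p).-1.
Proof. by rewrite size_map size_iota. Qed.

Lemma size_pderiv p : size (pderiv p) = (size p).-1.
Proof. by rewrite size_map size_iota. Qed.

Lemma size_prem_step q p : (0 < size q)%N -> (size q <= size p)%N ->
  size (prem_step q p) = (size p).-1.
Proof.
move=> q0 qp; rewrite /prem_step q0 qp /= size_padd size_cat size_nseq !size_pscale !size_ptrunc.
by apply/maxn_idPl; lia.
Qed.

Lemma prem_stepN q p : (size p < size q)%N -> prem_step q p = p.
Proof. by move=> pq; rewrite /prem_step [(size q <= _)%N]leqNgt pq andbF. Qed.

Lemma prem_small p q : (size p < size q)%N -> prem p q = p.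
Proof.
by move=> pq; rewrite /prem; elim: (size p) => //= n ->; exact: prem_stepN.
Qed.

Lemma prem_nil p : prem p [::] = p.
Proof. by rewrite /prem; elim: (size p) => //= n ->. Qed.

Lemma size_prem p q : (0 < size q)%N -> (size (prem p q) < size q)%N.
Proof.
move=> q0; rewrite /prem.
suff H n r : (size r < size q + n)%N -> (size (iter n (prem_step q) r) < size q)%N.
  by apply: H; rewrite -[X in (X < _)%N]add0n ltn_add2r.
elim: n r => [|n IHn] r; first by rewrite addn0.
move=> rn; rewrite iterSr; apply: IHn; case: (leqP (size q) (size r)) => qr.
  by rewrite size_prem_step //; lia.
by rewrite prem_stepN //; lia.
Qed.

(** At a root of [q] the leading term of [q] is minus its truncation, so each effective step
    multiplies the value of [p] by the square of the leading coefficient of [q], which is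
    positive. *)
Lemma sgn_prem rho p q x : (pol rho q).[x] = 0 -> eval rho (plead q) != 0 -> (0 < size q)%N ->
  sgn (pol rho (prem p q)).[x] = sgn (pol rho p).[x].
Proof.
move=> qx lq q0; rewrite /prem; elim: (size p) => //= n <-.
set r := iter n _ p; case: (leqP (size q) (size r)) => qr; last by rewrite prem_stepN.
rewrite /prem_step q0 qr /= pol_padd hornerD pol_pscale hornerZ horner_shift pol_pscale hornerZ.
rewrite eval_oppE !evalM.
move: qx; rewrite horner_trunc // => /eqP; rewrite addr_eq0 => /eqP ->.
rewrite [in RHS]horner_trunc; last exact: leq_trans qr.
rewrite -[in RHS](sgn_pmul _ (a := eval rho (plead q) * eval rho (plead q))); last first.
  by rewrite -expr2 exprn_even_gt0.
congr sgn; rewrite [in RHS]mulrDr; congr (_ + _).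
have -> : (size r).-1 = ((size r - size q) + (size q).-1)%N by lia.
by rewrite exprD; ring.
Qed.

Lemma horner_abstr rho v e x : (pol rho (abstr v e)).[x] = eval (upd rho v x) e.
Proof.
elim: e => [n|p m q|a IHa b IHb|a IHa b IHb] /=.
- rewrite /abstr /=; case: ifP => nv.
    rewrite !pol_cons pol_nil mul0r add0r eval_zeroE eval_oneE addr0 mul1r hornerX.
    by rewrite /eval /= /upd nv.
  by rewrite pol_cons pol_nil mul0r add0r hornerC /eval /= /upd nv.
- by rewrite /abstr /= pol_cons pol_nil mul0r add0r hornerC.
- by rewrite [abstr _ _]/(padd _ _) pol_padd hornerD IHa IHb.
- by rewrite [abstr _ _]/(pmul _ _) pol_pmul hornerM IHa IHb.
Qed.

End Eval.

(** * Signs of a polynomial on an interval where its derivative has constant sign *)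

Section Interval.
Variable R : rcfType.
Implicit Types (lo hi : option R) (x y : R) (p : {poly R}) (s : nat).

(** [None] is minus infinity as a lower end and plus infinity as an upper end. *)
Definition above lo x : bool := if lo is Some a then a < x else true.
Definition below hi x : bool := if hi is Some b then x < b else true.

Definition sign_at_left p lo s : Prop :=
  if lo is Some a then sgn p.[a] = s
  else s != 0%N /\ exists a, forall x, x <= a -> sgn p.[x] = s.
Definition sign_at_right p hi s : Prop :=
  if hi is Some b then sgn p.[b] = s
  else s != 0%N /\ exists b, forall x, b <= x -> sgn p.[x] = s.

Definition opposite s s' : bool := (s != 0%N) && ((s' != 0%N) && (s != s')).

(** The semantic counterpart of [split_col]. *)
Definition splits p lo hi sl sr : Prop :=
  if opposite sl sr then
    exists y, [/\ above lo y, below hi y, p.[y] = 0,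
                  forall x, above lo x -> x < y -> sgn p.[x] = sl
                & forall x, y < x -> below hi x -> sgn p.[x] = sr]
  else (if sl == 0%N then sr else sl) != 0%N /\
       forall x, above lo x -> below hi x -> sgn p.[x] = if sl == 0%N then sr else sl.

(** Replaces a possibly infinite end by a real number at which [p] has the sign of that end; finite
    and infinite ends are then handled alike. *)
Lemma left_witness p lo s x : sign_at_left p lo s -> above lo x ->
  exists2 z, z < x & sgn p.[z] = s /\ (forall y, z < y -> above lo y).
Proof.
case: lo => [a|] /=; first by move=> ha ax; exists a.
move=> [_ [a ha]] _; exists (Num.min a (x - 1)); first by rewrite gt_min ltrBlDr ltrDl ltr01 orbT.
by split=> //; apply: ha; rewrite ge_min lexx.
Qed.

Lemma right_witness p hi s x : sign_at_right p hi s -> below hi x ->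
  exists2 z, x < z & sgn p.[z] = s /\ (forall y, y < z -> below hi y).
Proof.
case: hi => [b|] /=; first by move=> hb xb; exists b.
move=> [_ [b hb]] _; exists (Num.max b (x + 1)); first by rewrite lt_max ltrDl ltr01 orbT.
by split=> //; apply: hb; rewrite le_max lexx.
Qed.

Lemma below_trans hi x y : x < y -> below hi y -> below hi x.
Proof. by case: hi => //= b; apply: lt_trans. Qed.

Lemma above_trans lo x y : x < y -> above lo x -> above lo y.
Proof. by case: lo => //= a xy ax; apply: lt_trans ax xy. Qed.

Lemma splits_incr p lo hi sl sr z : above lo z -> below hi z ->
  (forall x, above lo x -> below hi x -> 0 < p^`().[x]) ->
  sign_at_left p lo sl -> sign_at_right p hi sr -> splits p lo hi sl sr.
Proof.
move=> loz hiz dp hl hr.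
(* The mean value theorem uses the derivative only strictly between [x] and [y], so these may be the
   ends of the interval themselves. *)
have incr x y : x < y -> (forall c, x < c -> above lo c) -> (forall c, c < y -> below hi c) ->
    p.[x] < p.[y].
  move=> xy xlo yhi; have [c] := poly_mvt p xy.
  rewrite in_itv /= => /andP[xc cy] e; rewrite -subr_gt0 e mulr_gt0 ?subr_gt0 //.
  by apply: dp; [exact: xlo|exact: yhi].
have [zl zlz [sl_zl above_zl]] := left_witness hl loz.
have [zr zzr [sr_zr below_zr]] := right_witness hr hiz.
(* Each inner value lies strictly between two values of [p] that carry the end signs, so unless
   these are opposite its sign is that of a nonvanishing end. *)
have main x : above lo x -> below hi x ->
    exists a b, [/\ p.[a] < p.[x], p.[x] < p.[b], sgn p.[a] = sl & sgn p.[b] = sr].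
  move=> lox hix; have [a ax [sa aa]] := left_witness hl lox.
  have [b xb [sb bb]] := right_witness hr hix; exists a, b; split => //; apply: incr => // c cx.
    exact: below_trans hix.
  exact: above_trans lox.
rewrite /splits; case: ifP => op; last first.
  have H x : above lo x -> below hi x ->
     (if sl == 0%N then sr else sl) != 0%N /\ sgn p.[x] = (if sl == 0%N then sr else sl).
    move=> lox hix; have [a [b [ax xb sa sb]]] := main _ lox hix.
    move: op; rewrite /opposite -sa -sb.
    case: (sgnP p.[a]) => -[ha ->]; case: (sgnP p.[b]) => -[hb ->] //= _;
      clear -ha hb ax xb;
      first [by exfalso; lra
        | by have px : 0 < p.[x]; [lra|rewrite (sgn_pos px)]
        | by have px : p.[x] < 0; [lra|rewrite (sgn_neg px)]].
  by split=> [|x lox hix]; [have [] := H z loz hiz|have [] := H x lox hix].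
have zlr : p.[zl] < p.[zr].
  by apply: incr => //; apply: lt_trans zzr.
have [zl0 zr0] : p.[zl] < 0 /\ 0 < p.[zr].
  move: op; rewrite /opposite -sl_zl -sr_zr.
  by case: (sgnP p.[zl]) => -[ha ->]; case: (sgnP p.[zr]) => -[hb ->] //= _;
    clear -ha hb zlr; first [by exfalso; lra | by []].
have [|y] := @poly_ivtoo _ p _ _ (ltW (lt_trans zlz zzr)); first by rewrite nmulr_rlt0.
rewrite in_itv /= => /andP[zly yzr] /rootP py0.
have lo_y := above_zl _ zly; have hi_y := below_zr _ yzr.
exists y; split=> // x; last first.
  move=> yx hix; rewrite -sr_zr [RHS]sgn_pos // sgn_pos // -py0; apply: incr => // c.
    by move=> yc; apply: above_trans lo_y.
  by move=> cx; apply: below_trans hix.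
move=> lox xy; rewrite -sl_zl [RHS]sgn_neg // sgn_neg // -py0; apply: incr => // c.
  by move=> xc; apply: above_trans lox.
by move=> cy; apply: below_trans hi_y.
Qed.

Lemma flipK s : (s < 3)%N -> flip (flip s) = s.
Proof. by case: s => [|[|[|]]]. Qed.

Lemma sgn_lt3 x : (sgn x < 3)%N.
Proof. by case: (sgnP x) => -[_ ->]. Qed.

Lemma sign_at_leftN p lo s : (s < 3)%N -> sign_at_left p lo s -> sign_at_left (- p) lo (flip s).
Proof.
move=> s3; case: lo => [a|] /=; first by move=> <-; rewrite hornerN sgnN.
move=> [s0 [a ha]]; split; first by rewrite flip_eq0.
by exists a => x xa; rewrite hornerN sgnN ha.
Qed.

Lemma sign_at_rightN p hi s : (s < 3)%N -> sign_at_right p hi s -> sign_at_right (- p) hi (flip s).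
Proof.
move=> s3; case: hi => [a|] /=; first by move=> <-; rewrite hornerN sgnN.
move=> [s0 [a ha]]; split; first by rewrite flip_eq0.
by exists a => x xa; rewrite hornerN sgnN ha.
Qed.

Lemma opposite_flip s s' : (s < 3)%N -> (s' < 3)%N -> opposite (flip s) (flip s') = opposite s s'.
Proof. by case: s => [|[|[|]]] //; case: s' => [|[|[|]]]. Qed.

Lemma splitsN p lo hi sl sr : (sl < 3)%N -> (sr < 3)%N ->
  splits (- p) lo hi (flip sl) (flip sr) -> splits p lo hi sl sr.
Proof.
move=> sl3 sr3; rewrite /splits opposite_flip //.
have sgnE x s : (s < 3)%N -> sgn (- p).[x] = flip s -> sgn p.[x] = s.
  by move=> s3 e; rewrite -[p]opprK hornerN sgnN e flipK.
case: ifP => _.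
  case=> y [h1 h2 h3 h4 h5]; exists y; split=> // [|x lx xy|x yx xh].
  - by apply/eqP; rewrite -oppr_eq0 -hornerN h3.
  - by apply: sgnE => //; exact: h4.
  - by apply: sgnE => //; exact: h5.
rewrite flip_eq0 //; set s := (if _ then sr else sl).
have s3 : (s < 3)%N by rewrite /s; case: ifP.
have -> : (if sl == 0%N then flip sr else flip sl) = flip s by rewrite /s; case: ifP.
by rewrite flip_eq0 // => -[s0 H]; split=> // x lx xh; apply: sgnE => //; exact: H.
Qed.

Lemma sign_at_left_lt3 p lo s : sign_at_left p lo s -> (s < 3)%N.
Proof.
case: lo => [a <-|[_ [a /(_ a (lexx a)) <-]]]; exact: sgn_lt3.
Qed.

Lemma sign_at_right_lt3 p hi s : sign_at_right p hi s -> (s < 3)%N.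
Proof.
case: hi => [a <-|[_ [a /(_ a (lexx a)) <-]]]; exact: sgn_lt3.
Qed.

Lemma splitsP p lo hi sl sr z s : above lo z -> below hi z -> s != 0%N ->
  (forall x, above lo x -> below hi x -> sgn p^`().[x] = s) ->
  sign_at_left p lo sl -> sign_at_right p hi sr -> splits p lo hi sl sr.
Proof.
move=> loz hiz s0 dp hl hr; have := dp z loz hiz.
case: (sgnP p^`().[z]) => -[_ ->] es; first by rewrite -es in s0.
  apply: splits_incr loz hiz _ hl hr => x lox hix; have := dp x lox hix; rewrite -es.
  by case: (sgnP p^`().[x]) => -[h ->].
have sl3 := sign_at_left_lt3 hl; have sr3 := sign_at_right_lt3 hr.
apply: splitsN => //; apply: splits_incr loz hiz _ _ _; first last.
- exact: sign_at_rightN.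
- exact: sign_at_leftN.
move=> x lox hix; have := dp x lox hix; rewrite -es derivN hornerN oppr_gt0.
by case: (sgnP p^`().[x]) => -[h ->].
Qed.

Lemma sign_at_pinfty p : lead_coef p != 0 -> sign_at_right p None (sgn (lead_coef p)).
Proof.
move=> lp /=; rewrite sgn_eq0; split=> //.
case: (sgnP (lead_coef p)) => -[h ->]; first by rewrite h eqxx in lp.
  have [b hb] := poly_pinfty_gt_lc h; exists b => x /hb px.
  by rewrite sgn_pos // (lt_le_trans h).
have [|b hb] := @poly_pinfty_gt_lc _ (- p); first by rewrite lead_coefN oppr_gt0.
exists b => x /hb; rewrite lead_coefN hornerN lerN2 => px.
by rewrite sgn_neg // (le_lt_trans px).
Qed.

(** Minus infinity for [p] is plus infinity for [p(-X)], whose leading coefficient changes sign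
    exactly when the degree is odd. *)
Lemma sign_at_minfty p : lead_coef p != 0 ->
  sign_at_left p None (if odd (size p) then sgn (lead_coef p) else flip (sgn (lead_coef p))).
Proof.
move=> lp; pose q := p \Po - 'X.
have lqE : lead_coef q = (if odd (size p) then lead_coef p else - lead_coef p).
  rewrite lead_coef_comp ?size_polyN ?size_polyX // lead_coefN lead_coefX.
  rewrite lead_coef_eq0 -size_poly_gt0 in lp.
  rewrite -signr_odd; case: (size p) lp => //= n _; case: (odd n) => /=.
    by rewrite mulrN1.
  by rewrite mulr1.
have lq : lead_coef q != 0 by rewrite lqE; case: ifP => // _; rewrite oppr_eq0.
have -> : (if odd (size p) then sgn (lead_coef p) else flip (sgn (lead_coef p))) =
   sgn (lead_coef q) by rewrite lqE; case: ifP; rewrite ?sgnN.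
have [s0 [b hb]] := sign_at_pinfty lq; split=> //; exists (- b) => x xb.
rewrite -(hb (- x)) 1?lerNr // /q horner_comp hornerN hornerX opprK //.
Qed.

End Interval.

(** * Closure of a family under derivatives, truncations and pseudo-remainders *)

Section Closure.
Implicit Types (p q : seq expr) (E F : seq (seq expr)).

Lemma msizeP F p : p \in F -> (size p <= msize F)%N.
Proof.
elim: F => //= q F IHF; rewrite inE leq_max => /orP[/eqP ->|/IHF ->]; by rewrite ?leqnn ?orbT.
Qed.

Lemma cstep_sub F : {subset F <= cstep F}.
Proof. by move=> p pF; rewrite mem_cat pF. Qed.

(** The last clause lets a production be replayed in an earlier family that already contains both
    parents. Remainders that leave [p] unchanged count as old. *)
Lemma cstepP F (r : seq expr) : r \in cstep F ->
  r \in F \/ exists p q, [/\ p \in F, q \in F, (size r < size p)%N, (size r < size q)%N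
    & (forall F', p \in F' -> q \in F' -> r \in cstep F')].
Proof.
rewrite !mem_cat => /orP[-> |]; first by left.
have empty p : (size p == 0)%N -> p = [::] by case: p.
case/or3P => [/mapP[p pF ->]|/mapP[p pF ->]|/flattenP[s /mapP[p pF ->] /mapP[q qF ->]]].
- case: (posnP (size p)) => [/eqP/empty pE|p0]; first by left; move: pF; rewrite pE.
  have lt_p : ((size p).-1 < size p)%N by lia.
  right; exists p, p; rewrite size_pderiv; split=> // F' pF' _.
  by rewrite !mem_cat (map_f pderiv pF') orbT.
- case: (posnP (size p)) => [/eqP/empty pE|p0]; first by left; move: pF; rewrite pE.
  have lt_p : ((size p).-1 < size p)%N by lia.
  right; exists p, p; rewrite size_ptrunc; split=> // F' pF' _.
  by rewrite !mem_cat (map_f ptrunc pF') !orbT.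
- case: (ltnP (size p) (size q)) => pq; first by left; rewrite prem_small.
  case: (posnP (size q)) => [/eqP/empty ->|q0]; first by left; rewrite prem_nil.
  right; exists p, q; have rq := size_prem p q0; split=> //; first exact: leq_trans pq.
  move=> F' pF' qF'; rewrite !mem_cat; apply/or4P; apply: Or44.
  apply/flattenP; exists [seq prem p q | q <- F']; last exact: map_f.
  exact: (map_f (fun p => [seq prem p q | q <- F'])).
Qed.

(* Every new polynomial is smaller than its parents, so the polynomials of size at least
   [msize E - i] are stable after [i] steps. *)
Lemma close_stable E i (r : seq expr) : r \in iter i.+1 cstep E -> (msize E - i <= size r)%N ->
  r \in iter i cstep E.
Proof.
elim: i r => [|i IHi] r; rewrite iterS => /cstepP[//|[p [q [pF qF rp rq rcl]]]].
  by rewrite subn0 => /leq_ltn_trans/(_ rp); rewrite ltnNge (msizeP pF).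
move=> mr; rewrite iterS; apply: rcl; apply: IHi => //; lia.
Qed.

Lemma close_cstep E : {subset cstep (close E) <= close E}.
Proof. by move=> r rF; apply: close_stable => //; rewrite subnn. Qed.

Lemma close_pderiv E p : p \in close E -> pderiv p \in close E.
Proof. by move=> pE; apply: close_cstep; rewrite !mem_cat (map_f pderiv pE) orbT. Qed.

Lemma close_ptrunc E p : p \in close E -> ptrunc p \in close E.
Proof. by move=> pE; apply: close_cstep; rewrite !mem_cat (map_f ptrunc pE) !orbT. Qed.

Lemma close_prem E p q : p \in close E -> q \in close E -> prem p q \in close E.
Proof.
move=> pE qE; apply: close_cstep; rewrite !mem_cat; apply/or4P; apply: Or44.
apply/flattenP; exists [seq prem p q | q <- close E]; last exact: map_f.
exact: (map_f (fun p => [seq prem p q | q <- close E])).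
Qed.

Lemma close_sub E : {subset E <= close E}.
Proof.
rewrite /close; elim: (msize E) => // n IHn p pE.
by rewrite iterS; apply: cstep_sub; apply: IHn.
Qed.

(** Prefixes are iterated truncations; this keeps [norm S p] in the closed family. *)
Lemma close_take E p k : p \in close E -> take k p \in close E.
Proof.
elim: {p}(size p) {-2}p (erefl (size p)) => [|n IHn] p sp pE.
  by rewrite take_oversize // sp.
case: (ltnP k (size p)) => kp; last by rewrite take_oversize.
have -> : take k p = take k (ptrunc p) by rewrite ptruncE take_takel //; lia.
by apply: IHn; rewrite ?size_ptrunc ?sp //; apply: close_ptrunc.
Qed.

End Closure.

(** * Normalization under an assignment that is correct at a valuation *)

Section Norm.
Variables (R : rcfType) (rho : nat -> R) (S : seq (expr * nat)).
Implicit Types (p q : seq expr).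

Definition good p : Prop := forall c, c \in p -> lookup S c = sgn (eval rho c).

Lemma norm_take p : exists k, norm S p = take k p.
Proof.
elim: p => [|c p [k IHp]] /=; first by exists 0%N.
case: ifP => _; [by exists 0%N|exists k.+1]; by rewrite IHp.
Qed.

Lemma pol_norm p : good p -> pol rho (norm S p) = pol rho p.
Proof.
elim: p => //= c p IHp gp.
have /IHp {}IHp : good p by move=> d dp; apply: gp; rewrite inE dp orbT.
case: ifP => [/andP[/eqP/size0nil n0 /eqP c0]|_]; last by rewrite !pol_cons IHp.
rewrite pol_cons -IHp n0 pol_nil mul0r add0r.
have := gp c (mem_head _ _); rewrite c0 => /esym/eqP; rewrite sgn_eq0 => /eqP ->.
by rewrite polyC0.
Qed.

Lemma plead_cons c p : p != [::] -> plead (c :: p) = plead p.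
Proof. by case: p. Qed.

Lemma lead_norm p : good p -> norm S p != [::] -> eval rho (plead (norm S p)) != 0.
Proof.
elim: p => //= c p IHp gp.
have gp' : good p by move=> d dp; apply: gp; rewrite inE dp orbT.
case: ifP => // h _; case: (eqVneq (norm S p) [::]) h => [->|np _].
  by rewrite /= /plead /= -sgn_eq0 -gp ?mem_head // => ->.
by rewrite plead_cons // IHp.
Qed.

Lemma plead_in p : p != [::] -> plead p \in p.
Proof. by move=> p0; rewrite mem_nth // ltn_predL lt0n size_eq0. Qed.

Lemma norm_id p : good p -> p != [::] -> eval rho (plead p) != 0 -> norm S p = p.
Proof.
elim: p => //= c p IHp gp _ lp.
have gp' : good p by move=> d dp; apply: gp; rewrite inE dp orbT.
case: (eqVneq p [::]) lp => [-> |p0 lp] /=.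
  by rewrite /plead /= -sgn_eq0 -gp ?mem_head // => /negbTE ->.
rewrite plead_cons // in lp; rewrite IHp //.
by case: p p0 {IHp gp gp' lp}.
Qed.

Lemma size_pol p : p != [::] -> eval rho (plead p) != 0 -> size (pol rho p) = size p.
Proof.
move=> p0 lp; apply/eqP; rewrite eqn_leq; apply/andP; split.
  by rewrite -(size_map (eval rho) p) size_Poly.
rewrite leqNgt; apply: contra lp => h.
have h' : (size (pol rho p) <= (size p).-1)%N by rewrite -ltnS prednK // lt0n size_eq0.
by rewrite /plead -coef_pol nth_default.
Qed.

Lemma lead_pol p : p != [::] -> eval rho (plead p) != 0 ->
  lead_coef (pol rho p) = eval rho (plead p).
Proof. by move=> p0 lp; rewrite lead_coefE size_pol // coef_pol. Qed.

(** By characteristic zero, the derivative of a normalized nonconstant polynomial is normalized,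
    hence it occurs in the table as it is. *)
Lemma lead_pderiv p : (1 < size p)%N -> eval rho (plead p) != 0 ->
  eval rho (plead (pderiv p)) != 0.
Proof.
move=> p1 lp; rewrite /plead size_pderiv (nth_map 0%N) ?size_iota; last lia.
rewrite nth_iota ?add0n; last lia.
rewrite evalM mulf_neq0 //; first by rewrite /eval /= subr0 divr1 pnatr_eq0.
by have -> : (size p).-1.-1.+1 = (size p).-1 by lia.
Qed.

End Norm.

(** * Realized tables and the insertion of one polynomial *)

Section Realize.
Variables (R : rcfType) (rho : nat -> R) (S : seq (expr * nat)).
Implicit Types (p q P : seq expr) (L : seq (seq expr)) (c : column) (x y : R).

Definition col_ok x c : bool := all (fun e => sgn (pol rho e.1).[x] == e.2) c.

(** Two invariants drive the insertion: nonzero signs on intervals make a polynomial with listed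
    derivative strictly monotone there, and a nonconstant polynomial vanishing at each point
    provides the divisor for [psign]. *)
Definition interval_col L c : Prop :=
  [seq e.1 | e <- c] = L /\ all (fun e => e.2 != 0%N) c.
Definition point_col L c : Prop :=
  [seq e.1 | e <- c] = L /\ has (fun e => (e.2 == 0%N) && (1 < size e.1)%N) c.

(** A table fixes the number and order of the points but not the points, which depend on [rho]; each
    is chosen existentially to the right of the previous one, [lo]. *)
Fixpoint realize L (lo : option R) c (T : seq (column * column)) : Prop :=
  interval_col L c /\
  if T is d :: T' then
    point_col L d.1 /\
    exists y, [/\ above lo y, forall x, above lo x -> x < y -> col_ok x c,
                  col_ok y d.1 & realize L (Some y) d.2 T']
  else forall x, above lo x -> col_ok x c.

Lemma csignP x c p : col_ok x c -> p = [::] \/ p \in [seq e.1 | e <- c] ->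
  csign c p = sgn (pol rho p).[x].
Proof.
move=> ok; rewrite /csign; case: (eqVneq p [::]) => [-> _|p0].
  by rewrite pol_nil horner0 sgn0.
rewrite size_eq0 (negbTE p0) => -[e|]; first by rewrite e in p0.
elim: c ok => //= e c IHc /andP[/eqP eok cok]; rewrite inE.
by case: (eqVneq e.1 p) => [<- _|ne]; [rewrite eok|exact: IHc].
Qed.

Lemma zero_ofP L c : point_col L c ->
  [/\ zero_of c \in L, (1 < size (zero_of c))%N & (zero_of c, 0%N) \in c].
Proof.
move=> [<-]; elim: c => //= e c IHc; case: ifP => [/andP[/eqP e0 e1] _|_ /= /IHc[h1 h2 h3]].
  by rewrite inE eqxx e1; split=> //; rewrite -e0 -surjective_pairing mem_head.
by rewrite !inE h1 h3 !orbT.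
Qed.

Section Refine.
Variables (L : seq (seq expr)) (P : seq expr).
Hypothesis SP : lookup S (plead P) = sgn (eval rho (plead P)).
Hypothesis lP : eval rho (plead P) != 0.
Hypothesis lL : forall q, q \in L -> eval rho (plead q) != 0.
Hypothesis dL : (1 < size P)%N -> pderiv P \in L.
Hypothesis rL : forall q, q \in L -> (1 < size q)%N ->
  (norm S (prem P q) = [::] \/ norm S (prem P q) \in L) /\
  pol rho (norm S (prem P q)) = pol rho (prem P q).

Lemma psignP y c : point_col L c -> col_ok y c -> psign S c P = sgn (pol rho P).[y].
Proof.
move=> Lc ok; have [qL q1 q0] := zero_ofP Lc; have [rm rp] := rL qL q1.
rewrite /psign (csignP ok) ?rp; last by rewrite (proj1 Lc).
apply: sgn_prem; [|exact: lL|exact: ltnW].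
by move/allP: ok => /(_ _ q0) /= /[!sgn_eq0] /eqP.
Qed.

Lemma interval_col_cons s c : s != 0%N -> interval_col L c -> interval_col (P :: L) ((P, s) :: c).
Proof. by move=> s0 [cL c0]; split=> /=; rewrite ?cL // s0. Qed.

Lemma realize_const lo c T : (size P <= 1)%N -> realize L lo c T ->
  realize (P :: L) lo (refine_const (lookup S (plead P)) P (c, T)).1
    (refine_const (lookup S (plead P)) P (c, T)).2.
Proof.
move=> P1; have P0 : P != [::] by apply: contraNneq lP => ->; rewrite /plead /= eval_zeroE.
have S0 : lookup S (plead P) != 0%N by rewrite SP sgn_eq0.
have polE x : (pol rho P).[x] = eval rho (plead P).
  have : (size P == 1)%N by rewrite eqn_leq P1 lt0n size_eq0.
  by case: (P) => [|a []] // _; rewrite pol_cons pol_nil mul0r add0r hornerC.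
have okI x d : col_ok x d -> col_ok x ((P, lookup S (plead P)) :: d).
  by rewrite /= polE SP eqxx.
elim: T lo c => [|d T IHT] lo c /=.
  by move=> [Lc H]; split=> [|x lx]; [exact: interval_col_cons|exact: okI (H x lx)].
move=> [Lc [Ld [y [loy H1 H2 H3]]]]; split; first exact: interval_col_cons.
split; first by case: Ld => dL' h0; split=> /=; rewrite ?dL' // h0 orbT.
exists y; split=> //; [by move=> x lx xy; exact: okI (H1 x lx xy)|exact: okI|exact: IHT].
Qed.

Hypothesis P1 : (1 < size P)%N.

Lemma interval_splits lo hi sl sr c z : above lo z -> below hi z -> interval_col L c ->
  (forall x, above lo x -> below hi x -> col_ok x c) ->
  sign_at_left (pol rho P) lo sl -> sign_at_right (pol rho P) hi sr ->
  splits (pol rho P) lo hi sl sr.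
Proof.
move=> loz hiz [cL c0] ok hl hr.
have dc : pderiv P \in [seq e.1 | e <- c] by rewrite cL dL.
have [e ec eE] := mapP dc.
apply: (splitsP (s := e.2) loz hiz) => //; first by move/allP: c0 => /(_ _ ec).
by move=> x lx hx; move/allP: (ok x lx hx) => /(_ _ ec) /eqP <-; rewrite -eE pol_pderiv.
Qed.

(** The induction moves from left to right although the fold computes from the right: the sign at
    the left end is carried by [sl], and the fold supplies the sign at the next point, or at plus
    infinity. *)
Lemma realize_fold lo c T sl : realize L lo c T -> sign_at_left (pol rho P) lo sl ->
  realize (P :: L) lo (split_col sl c P (refine_fold S P T).1).1
    ((split_col sl c P (refine_fold S P T).1).2 ++ (refine_fold S P T).2).
Proof.
have P0 : P != [::] by case: (P) P1.
have okE x s d : col_ok x ((P, s) :: d) = (sgn (pol rho P).[x] == s) && col_ok x d by [].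
elim: T lo c sl => [|d T IHT] lo c sl.
  move=> [Lc ok] hl.
  have hr : sign_at_right (pol rho P) None (lookup S (plead P)).
    by rewrite SP -lead_pol //; apply: sign_at_pinfty; rewrite lead_pol.
  have [z loz] : exists z, above lo z.
    by case: (lo) => [a|]; [exists (a + 1); rewrite /= ltrDl ltr01|exists 0].
  have := interval_splits (hi := None) loz isT Lc (fun x lx _ => ok x lx) hl hr.
  rewrite /splits /split_col -/(opposite _ _) [(refine_fold _ _ _).1]/=; case: ifP => op.
    move=> [y [loy _ py Hl Hr]]; move/and3P: op => [sl0 sr0 _] /=.
    split; first exact: interval_col_cons.
    split; first by split; [rewrite /= (proj1 Lc)|rewrite /= P1].
    exists y; split=> //.
    - by move=> x lx xy; rewrite Hl // eqxx; apply: ok.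
    - by rewrite py sgn0 eqxx; apply: ok.
    split; first exact: interval_col_cons.
    by move=> x /= yx; rewrite Hr // eqxx; apply: ok; apply: above_trans loy.
  move=> [s0 H] /=; split; first exact: interval_col_cons.
  by move=> x lx; rewrite H // eqxx; apply: ok.
move=> [Lc [Ld [y [loy okc okd Hy]]]] hl.
have py := psignP Ld okd.
have hl' : sign_at_left (pol rho P) (Some y) (psign S d.1 P) by rewrite py.
have hr : sign_at_right (pol rho P) (Some y) (psign S d.1 P) by rewrite py.
have {}IHT := IHT (Some y) d.2 _ Hy hl'.
have Ld' : point_col (P :: L) ((P, psign S d.1 P) :: d.1).
  by case: Ld => Ld h; split=> /=; rewrite ?Ld // h orbT.
have okd' : col_ok y ((P, psign S d.1 P) :: d.1) by rewrite okE py eqxx.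
have [z loz hiz] : exists2 z, above lo z & z < y.
  case: (lo) loy => [a /= ay|_]; last by exists (y - 1); rewrite // ltrBlDr ltrDl ltr01.
  by exists ((a + y) / 2); lra.
have := interval_splits (hi := Some y) loz hiz Lc okc hl hr.
rewrite [refine_fold S P (d :: T)]/=.
set s := psign S d.1 P in py hl' hr IHT Ld' okd' *.
set F := refine_fold S P T in IHT *; set T' := split_col s d.2 P _ in IHT *.
rewrite /splits [split_col sl c P _]/split_col -/(opposite _ _) [(s, _).1]/= [(s, _).2]/=.
case: ifP => op.
  move=> [w [low why pw Hl Hr]]; move/and3P: op => [sl0 sr0 _] /=.
  split; first exact: interval_col_cons.
  split; first by split; [rewrite /= (proj1 Lc)|rewrite /= P1].
  exists w; split=> //.
  - by move=> x lx xw; rewrite Hl // eqxx; apply: okc => //; apply: lt_trans why.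
  - by rewrite pw sgn0 eqxx; apply: okc.
  split; first exact: interval_col_cons.
  split=> //; exists y; split=> //.
  by move=> x /= wx xy; rewrite Hr // eqxx; apply: okc => //; apply: above_trans low.
move=> [s0 H] /=; split; first exact: interval_col_cons.
split=> //; exists y; split=> //.
by move=> x lx xy; rewrite H // eqxx; apply: okc.
Qed.

End Refine.

Lemma realize_refine L P (T : table) :
  lookup S (plead P) = sgn (eval rho (plead P)) -> eval rho (plead P) != 0 ->
  (forall q, q \in L -> eval rho (plead q) != 0) ->
  ((1 < size P)%N -> pderiv P \in L) ->
  (forall q, q \in L -> (1 < size q)%N ->
    (norm S (prem P q) = [::] \/ norm S (prem P q) \in L) /\
    pol rho (norm S (prem P q)) = pol rho (prem P q)) ->
  realize L None T.1 T.2 -> realize (P :: L) None (refine S P T).1 (refine S P T).2.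
Proof.
move=> SP lP lL dL rL; case: T => c T HT; rewrite /refine; case: leqP => P1.
  exact: realize_const.
apply: realize_fold => //.
have P0 : P != [::] by case: (P) P1.
rewrite /sign_minfty SP modn2 eqb1 -(size_pol P0 lP) -(lead_pol P0 lP).
by apply: sign_at_minfty; rewrite lead_pol.
Qed.

(** Together with [realize_cover], this makes the columns exactly the sign vectors that occur on the
    line. *)
Lemma realize_column L lo c T d : realize L lo c T -> d \in columns (c, T) ->
  [seq e.1 | e <- d] = L /\ exists x, col_ok x d.
Proof.
have ex_above (l : option R) : exists z, above l z.
  by case: l => [a|]; [exists (a + 1); rewrite /= ltrDl ltr01|exists 0].
elim: T lo c => [|t T IHT] lo c.
  move=> [[cL _] H]; rewrite /columns /= mem_seq1 => /eqP ->; split=> //.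
  by have [z loz] := ex_above lo; exists z; apply: H.
move=> [[cL _] [[tL _] [y [loy H1 H2 H3]]]]; rewrite /columns /= !inE.
case/or3P => [/eqP ->|/eqP ->|dT]; first 1 [split=> //]; last first.
- by apply: (IHT _ _ H3); rewrite inE.
- by split=> //; exists y.
have [z loz hiz] : exists2 z, above lo z & z < y.
  case: (lo) loy => [a /= ay|_]; last by exists (y - 1); rewrite // ltrBlDr ltrDl ltr01.
  by exists ((a + y) / 2); lra.
by exists z; apply: H1.
Qed.

Lemma realize_cover L lo c T x : realize L lo c T -> above lo x ->
  exists2 d, d \in columns (c, T) & col_ok x d.
Proof.
elim: T lo c => [|t T IHT] lo c.
  by move=> [_ H] lx; exists c; [rewrite mem_head|exact: H].
move=> [_ [_ [y [loy H1 H2 H3]]]] lx; case: (ltgtP x y) => [xy|yx|->].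
- by exists c; [rewrite mem_head|exact: H1].
- have [d dT dok] := IHT _ _ H3 yx; exists d => //.
  by rewrite /columns /= in dT *; rewrite !inE in dT *; rewrite dT !orbT.
- by exists t.1; rewrite ?H2 // /columns /= !inE eqxx orbT.
Qed.

End Realize.

(** * Correctness of the sign table of a closed family *)

Section SignTable.
Variables (R : rcfType) (rho : nat -> R) (S : seq (expr * nat)) (E : seq (seq expr)).
Let F := close E.
Hypothesis goodF : forall p, p \in F -> good rho S p.

Lemma norm_close p : p \in F -> norm S p \in F.
Proof. by move=> pF; have [k ->] := norm_take S p; exact: close_take. Qed.

Lemma mem_by_size n p :
  (p \in by_size S F n) = (p \in [seq norm S q | q <- F]) && (0 < size p <= n)%N.
Proof.
elim: n => [|n IHn]; first by rewrite in_nil leqn0 andbC; case: (size p).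
rewrite /by_size /natrec /= -/(natrec _ _ _) mem_cat -/(by_size S F n) IHn mem_filter.
case: (p \in _); rewrite ?andbF ?andbT //=.
by apply/idP/idP; lia.
Qed.

Lemma norm_mem p : p \in [seq norm S q | q <- F] -> p != [::] ->
  [/\ p \in F, good rho S p & eval rho (plead p) != 0].
Proof.
case/mapP => q qF ->; have gq := goodF qF; have nF := norm_close qF.
by split=> //; [exact: goodF|exact: lead_norm].
Qed.

(** The inner induction adds the polynomials of size [n.+1] one by one. Their order is irrelevant:
    derivatives are smaller, and a remainder is smaller than its divisor even when both polynomials
    have the same size, so all of them are found among sizes up to [n]. *)
Lemma realize_by_size n :
  realize rho (by_size S F n) None (foldr (refine S) ([::], [::]) (by_size S F n)).1
    (foldr (refine S) ([::], [::]) (by_size S F n)).2.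
Proof.
elim: n => [//|n IHn].
rewrite /by_size /natrec /= -/(natrec _ _ _) -/(by_size S F n).
set B := seq.filter _ _.
have : {subset B <= [pred p | (p \in [seq norm S q | q <- F]) && (size p == n.+1)]}.
  by move=> p; rewrite mem_filter andbC.
elim: B => [//|P B IHB] sub.
have subB : {subset B <= [pred p | (p \in [seq norm S q | q <- F]) && (size p == n.+1)]}.
  by move=> p pB; apply: sub; rewrite inE pB orbT.
have /andP[PF /eqP sP] := sub P (mem_head _ _).
have P0 : P != [::] by rewrite -size_eq0 sP.
have [PF' gP lP] := norm_mem PF P0.
have memB q : q \in B ++ by_size S F n ->
    [/\ q \in F, eval rho (plead q) != 0 & (0 < size q <= n.+1)%N].
  rewrite mem_cat => /orP[/subB /andP[qF /eqP sq]|].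
    have q0 : q != [::] by rewrite -size_eq0 sq.
    by have [? ? ?] := norm_mem qF q0; rewrite sq leqnn.
  rewrite mem_by_size => /andP[qF /andP[q0 qn]].
  have q0' : q != [::] by rewrite -size_eq0 -lt0n.
  by have [? ? ?] := norm_mem qF q0'; rewrite q0 leqW.
have small r : r \in F -> (size (norm S r) <= n)%N ->
    norm S r = [::] \/ norm S r \in B ++ by_size S F n.
  move=> rF rn; case: (eqVneq (norm S r) [::]) => [|r0]; [by left|right].
  by rewrite mem_cat mem_by_size (map_f (norm S) rF) rn lt0n size_eq0 r0 orbT.
apply: realize_refine => //.
- by apply: gP; rewrite plead_in.
- by move=> q /memB[].
- move=> P1; have dF := close_pderiv PF'.
  have d0 : pderiv P != [::] by rewrite -size_eq0 size_pderiv; lia.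
  have nd : norm S (pderiv P) = pderiv P.
    by apply: (norm_id (rho := rho)) => //; [exact: goodF|exact: lead_pderiv].
  have := small _ dF; rewrite nd size_pderiv sP => /(_ (leqnn n)) [e|//].
  by rewrite e in d0.
- move=> q /memB[qF _ /andP[q0 qn]] _; have rF := close_prem PF' qF.
  split; last by apply: pol_norm; exact: goodF.
  apply: small => //; have [k ->] := norm_take S (prem P q).
  by rewrite size_take_min geq_min -ltnS -[in X in _ || X]ltnS (leq_trans (size_prem P q0)) ?orbT.
- exact: IHB.
Qed.

Lemma columns_csign d x p : d \in columns (sign_table S F) -> col_ok rho x d -> p \in F ->
  csign d (norm S p) = sgn (pol rho p).[x].
Proof.
move=> dT ok pF; rewrite -(pol_norm (goodF pF)); apply: csignP => //.
have HT := realize_by_size (msize F).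
rewrite /sign_table [foldr _ _ _]surjective_pairing in dT.
have [-> _] := realize_column HT dT.
case: (eqVneq (norm S p) [::]) => [|n0]; [by left|right].
rewrite mem_by_size (map_f (norm S) pF) /= lt0n size_eq0 n0 /=.
by apply: msizeP; apply: norm_close.
Qed.

Lemma columns_realized d : d \in columns (sign_table S F) -> exists x, col_ok rho x d.
Proof.
move=> dT; have HT := realize_by_size (msize F).
rewrite /sign_table [foldr _ _ _]surjective_pairing in dT.
by have [_] := realize_column HT dT.
Qed.

Lemma columns_cover x : exists2 d, d \in columns (sign_table S F) & col_ok rho x d.
Proof.
have [d] := realize_cover (realize_by_size (msize F)) (isT : above None x).
by rewrite -surjective_pairing; exists d.
Qed.

End SignTable.

(** * Correctness of quantifier elimination *)

Section QE.
Variable R : rcfType.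
Implicit Types (rho : nat -> R) (D : dnf).

Definition sat rho D : bool := dnf_eval (fun e => sgn (eval rho e)) D.

Lemma dnf_eval_eq (f g : expr -> nat) D : {in dnf_exprs D, f =1 g} ->
  dnf_eval f D = dnf_eval g D.
Proof.
move=> fg; apply: eq_in_has => c cD; apply: eq_in_all => e ec; rewrite fg //.
by apply: map_f; apply/flattenP; exists c.
Qed.

Lemma assignmentsP rho (l : seq expr) : exists2 s, s \in assignments l &
  all (fun x => sgn (eval rho x.1) == x.2) s.
Proof.
elim: l => [|e l [s sl sok]]; first by exists [::].
exists ((e, sgn (eval rho e)) :: s); last by rewrite /= eqxx.
apply/flattenP; exists [seq (e, sgn (eval rho e)) :: a | a <- assignments l]; last exact: map_f.
exact: (map_f (fun n => [seq (e, n) :: a | a <- assignments l]) (sgn_in _)).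
Qed.

Lemma assignments_fst s (l : seq expr) : s \in assignments l -> [seq x.1 | x <- s] = l.
Proof.
elim: l s => [|e l IHl] s; first by rewrite mem_seq1 => /eqP ->.
rewrite [assignments _]/(flatten
  [seq [seq (e, n) :: a | a <- assignments l] | n <- [:: 0; 1; 2]%N]).
by case/flattenP => t /mapP[n _ ->] /mapP[a al ->] /=; rewrite IHl.
Qed.

Lemma lookupP rho s (l : seq expr) : s \in assignments l ->
  all (fun x => sgn (eval rho x.1) == x.2) s -> {in l, forall e, lookup s e = sgn (eval rho e)}.
Proof.
move=> /assignments_fst <-; elim: s => //= x s IHs /andP[/eqP xok sok] e; rewrite inE.
by case: (eqVneq x.1 e) => [<-|ne]; [rewrite xok|exact: IHs].
Qed.

(* Exactly the assignments that are true at [rho] matter, and there is one. *)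
Lemma sat_assignments rho (l : seq expr) (b : seq (expr * nat) -> bool) (c : bool) :
  (forall s, s \in assignments l -> {in l, forall e, lookup s e = sgn (eval rho e)} -> b s = c) ->
  sat rho [seq s <- assignments l | b s] = c.
Proof.
move=> bc; apply/idP/idP.
  case/hasP => s; rewrite mem_filter => /andP[bs sl] sok.
  by rewrite -(bc s sl (lookupP sl sok)).
move=> ct; have [s sl sok] := assignmentsP rho l; apply/hasP; exists s => //.
by rewrite mem_filter sl (bc s sl (lookupP sl sok)) ct.
Qed.

Lemma sat_or rho D D' : sat rho (qe_or D D') = sat rho D || sat rho D'.
Proof. exact: has_cat. Qed.

Lemma sat_and rho D D' : sat rho (qe_and D D') = sat rho D && sat rho D'.
Proof.
apply/hasP/andP.
  case=> t /flattenP[u /mapP[c cD ->] /mapP[c' cD' ->]]; rewrite all_cat => /andP[h h'].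
  by split; apply/hasP; [exists c|exists c'].
case=> /hasP[c cD h] /hasP[c' cD' h']; exists (c ++ c'); last by rewrite all_cat h.
apply/flattenP; exists [seq c ++ c' | c' <- D']; last exact: map_f.
exact: (map_f (fun c => [seq c ++ c' | c' <- D'])).
Qed.

Lemma sat_not rho D : sat rho (qe_not D) = ~~ sat rho D.
Proof.
apply: sat_assignments => s _ sE; congr (~~ _); exact: dnf_eval_eq.
Qed.

Lemma sat_ex rho v D : sat rho (qe_ex v D) <-> exists x, sat (upd rho v x) D.
Proof.
set E := [seq abstr v e | e <- dnf_exprs D].
have H s : {in flatten (close E), forall e, lookup s e = sgn (eval rho e)} ->
    reflect (exists x, sat (upd rho v x) D)
     (has (fun c => dnf_eval (fun e => csign c (norm s (abstr v e))) D)
      (columns (sign_table s (close E)))).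
  move=> sE; have goodF p : p \in close E -> good rho s p.
    by move=> pF c cp; apply: sE; apply/flattenP; exists p.
  have evE d x : d \in columns (sign_table s (close E)) -> col_ok rho x d ->
      dnf_eval (fun e => csign d (norm s (abstr v e))) D = sat (upd rho v x) D.
    move=> dT dok; apply: dnf_eval_eq => e eD.
    rewrite (columns_csign goodF dT dok) ?horner_abstr //.
    by apply: close_sub; apply: map_f.
  apply: (iffP hasP) => [[d dT]|[x xD]].
    by have [x dok] := columns_realized goodF dT; rewrite (evE _ _ dT dok); exists x.
  by have [d dT dok] := columns_cover goodF x; exists d => //; rewrite (evE _ _ dT dok).
(* Every assignment true at [rho] yields a Boolean reflecting the same existential statement, so the
   one obtained from [s0] is the common answer that [sat_assignments] asks for. *)
have [s0 s0l s0ok] := assignmentsP rho (flatten (close E)).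
have s0E := lookupP s0l s0ok.
rewrite (sat_assignments (c := has (fun c => dnf_eval (fun e => csign c (norm s0 (abstr v e))) D)
      (columns (sign_table s0 (close E))))); last first.
  by move=> s sl sE; apply/(H s sE)/(H s0 s0E).
by split=> /(H s0 s0E).
Qed.

End QE.

(** * Formulas *)

Definition subE (a b : expr) : expr := Add a (oppE b).
Definition sumE (n : nat) (f : nat -> expr) : expr :=
  foldr (fun i e => Add (f i) e) zeroE (iota 0 n).

Definition qe_true : dnf := [:: [::]].
Definition qe_lt (a b : expr) : dnf := [:: [:: (subE b a, 1%N)]].
Definition qe_le (a b : expr) : dnf := [:: [:: (subE b a, 0%N)]; [:: (subE b a, 1%N)]].
Definition qe_eq (a b : expr) : dnf := [:: [:: (subE b a, 0%N)]].
Definition qe_conj (n : nat) (F : nat -> dnf) : dnf :=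
  foldr (fun i D => qe_and (F i) D) qe_true (iota 0 n).
Definition qe_exs (vs : seq nat) (D : dnf) : dnf := foldr qe_ex D vs.
Definition qe_foralls (vs : seq nat) (D : dnf) : dnf := qe_not (qe_exs vs (qe_not D)).
Definition qe_imp (D D' : dnf) : dnf := qe_or (qe_not D) D'.

(* The value at the zero valuation, as a triple [(p, (m, q))] standing for [(p - m) / q]
   with [q > 0]; a constant with denominator zero is zero, as in [x / 0 = 0]. *)
Definition value0 (e : expr) : nat * (nat * nat) :=
  efold (fun _ => (0, (0, 1)))%N
    (fun p m q => if q == 0 then (0, (0, 1)) else (p, (m, q)))%N
    (fun a b => (a.1 * b.2.2 + b.1 * a.2.2, (a.2.1 * b.2.2 + b.2.1 * a.2.2, a.2.2 * b.2.2)))%N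
    (fun a b => (a.1 * b.1 + a.2.1 * b.2.1, (a.1 * b.2.1 + a.2.1 * b.1, a.2.2 * b.2.2)))%N e.
Definition sign0 (e : expr) : nat :=
  if (value0 e).1 == (value0 e).2.1 then 0%N
  else if ((value0 e).2.1 < (value0 e).1)%N then 1%N else 2%N.
Definition holds0 (D : dnf) : bool := dnf_eval sign0 D.

#[export] Instance subE_computable : Computable2 subE.
Proof. by rewrite /subE /oppE; computability. Qed.

Section FormulaBinders.
Context {A : Type} {EA : Enc A}.

Lemma computable_sumE (n : A -> nat) (f : A -> nat -> expr) :
  computable (fun p : A * nat => f p.1 p.2) -> computable n ->
  computable (fun a => sumE (n a) (f a)).
Proof. by move=> cf cn; have cf2 : Computable2 f := cf; rewrite /sumE; computability. Qed.

Lemma computable_qe_conj (n : A -> nat) (F : A -> nat -> dnf) :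
  computable (fun p : A * nat => F p.1 p.2) -> computable n ->
  computable (fun a => qe_conj (n a) (F a)).
Proof. by move=> cF cn; have cF2 : Computable2 F := cF; rewrite /qe_conj; computability. Qed.

End FormulaBinders.

Ltac computable_binder ::= first [simple eapply computable_natrec
  | simple eapply computable_iter | simple eapply computable_foldr | simple eapply computable_map
  | simple eapply computable_filter | simple eapply computable_has
  | simple eapply computable_all | simple eapply computable_efold
  | simple eapply computable_sumE | simple eapply computable_qe_conj].

#[export] Instance qe_exs_computable : Computable2 qe_exs.
Proof. by rewrite /qe_exs; computability. Qed.

#[export] Instance qe_lt_computable : Computable2 qe_lt.
Proof. by rewrite /qe_lt; computability. Qed.

#[export] Instance qe_le_computable : Computable2 qe_le.
Proof. by rewrite /qe_le; computability. Qed.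

#[export] Instance qe_eq_computable : Computable2 qe_eq.
Proof. by rewrite /qe_eq; computability. Qed.

#[export] Instance qe_foralls_computable : Computable2 qe_foralls.
Proof. by rewrite /qe_foralls; computability. Qed.

#[export] Instance qe_imp_computable : Computable2 qe_imp.
Proof. by rewrite /qe_imp; computability. Qed.

#[export] Instance value0_computable : Computable1 value0.
Proof. by rewrite /value0; computability. Qed.

#[export] Instance sign0_computable : Computable1 sign0.
Proof. by rewrite /sign0; computability. Qed.

#[export] Instance holds0_computable : Computable1 holds0.
Proof. by rewrite /holds0 /dnf_eval; computability. Qed.

(** * Semantics of the formulas *)

Section FormulaSat.
Variable R : rcfType.
Implicit Types (rho : nat -> R) (D : dnf) (a b : expr).

Lemma eval_subE rho a b : eval rho (subE a b) = eval rho a - eval rho b.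
Proof. by rewrite evalD eval_oppE. Qed.

Lemma eval_sumE rho n f : eval rho (sumE n f) = \sum_(i < n) eval rho (f i).
Proof.
rewrite /sumE -(big_mkord predT (fun i => eval rho (f i))) /index_iota subn0.
elim: (iota 0 n) => [|i s IHs] /=; first by rewrite big_nil eval_zeroE.
by rewrite big_cons -IHs.
Qed.

Lemma sgn_eq1 (x : R) : (sgn x == 1%N) = (0 < x).
Proof. by case: (sgnP x) => -[h ->] /=; rewrite ?h ?ltxx // lt_gtF. Qed.

Lemma sat_lt rho a b : sat rho (qe_lt a b) = (eval rho a < eval rho b).
Proof. by rewrite /sat /dnf_eval /= !orbF !andbT eval_subE sgn_eq1 subr_gt0. Qed.

Lemma sat_le rho a b : sat rho (qe_le a b) = (eval rho a <= eval rho b).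
Proof.
by rewrite /sat /dnf_eval /= !orbF !andbT eval_subE sgn_eq1 sgn_eq0 -subr_ge0 le0r.
Qed.

Lemma sat_eq rho a b : sat rho (qe_eq a b) = (eval rho a == eval rho b).
Proof. by rewrite /sat /dnf_eval /= !orbF !andbT eval_subE sgn_eq0 subr_eq0 eq_sym. Qed.

Lemma sat_conj rho n F : sat rho (qe_conj n F) = all (fun i => sat rho (F i)) (iota 0 n).
Proof. by rewrite /qe_conj; elim: (iota 0 n) => //= i s <-; rewrite sat_and. Qed.

Lemma sat_imp rho D D' : sat rho (qe_imp D D') = sat rho D ==> sat rho D'.
Proof. by rewrite sat_or sat_not implybE. Qed.

Lemma sat_exs rho vs D : sat rho (qe_exs vs D) <->
  exists2 rho', (forall n, n \notin vs -> rho' n = rho n) & sat rho' D.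
Proof.
elim: vs rho => [|v vs IHvs] rho /=.
  split=> [satD|[rho' rhoE satD]]; first by exists rho.
  suff -> : rho = rho' by [].
  by apply/funext => n; rewrite rhoE.
rewrite sat_ex; split.
  case=> x /IHvs[rho' rhoE satD]; exists rho' => // n.
  by rewrite inE negb_or => /andP[nv nvs]; rewrite rhoE // /upd (negbTE nv).
case=> rho' rhoE satD; exists (rho' v); apply/IHvs; exists rho' => // n nvs.
rewrite /upd; case: eqP => [-> //|/eqP nv]; apply: rhoE.
by rewrite inE negb_or nv.
Qed.

(** Simultaneous update of a block of variables: quantifying over the block becomes quantifying over
    a function [T -> R]. *)
Definition assign (T : finType) (v : T -> nat) (f : T -> R) rho : nat -> R :=
  fun n => if [pick x | v x == n] is Some x then f x else rho n.

Lemma assign_in (T : finType) (v : T -> nat) f rho x : injective v -> assign v f rho (v x) = f x.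
Proof.
move=> vinj; rewrite /assign; case: pickP => [y /eqP /vinj -> //|].
by move/(_ x); rewrite eqxx.
Qed.

Lemma assign_out (T : finType) (v : T -> nat) f rho n : (forall x, v x <> n) ->
  assign v f rho n = rho n.
Proof. by move=> nv; rewrite /assign; case: pickP => // x /eqP /nv. Qed.

Lemma sat_exs_assign (T : finType) (v : T -> nat) vs rho D : injective v ->
  vs =i codom v -> sat rho (qe_exs vs D) <-> exists f, sat (assign v f rho) D.
Proof.
move=> vinj vsE; rewrite sat_exs; split=> [[rho' rhoE satD]|[f satD]].
  exists (rho' \o v); suff -> : assign v (rho' \o v) rho = rho' by [].
  apply/funext => n; rewrite /assign; case: pickP => [x /eqP <- //|nv].
  rewrite rhoE // vsE; apply/negP => /codomP[x e]; by have := nv x; rewrite e eqxx.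
exists (assign v f rho) => // n; rewrite vsE => nv; apply: assign_out => x e.
by case/negP: nv; rewrite -e codom_f.
Qed.

Lemma sat_foralls_assign (T : finType) (v : T -> nat) vs rho D : injective v ->
  vs =i codom v -> sat rho (qe_foralls vs D) <-> forall f, sat (assign v f rho) D.
Proof.
move=> vinj vsE; rewrite sat_not; split=> [/negP nex f|H].
  apply: contraT => nsat; case: nex; apply/(sat_exs_assign _ _ vinj vsE).
  by exists f; rewrite sat_not.
by apply/negP => /(sat_exs_assign _ _ vinj vsE)[f]; rewrite sat_not H.
Qed.

Lemma value0P e : (0 < (value0 e).2.2)%N /\
  eval (fun _ => 0 : R) e = ((value0 e).1%:R - (value0 e).2.1%:R) / (value0 e).2.2%:R.
Proof.
elim: e => [n|p m q|a [a0 aE] b [b0 bE]|a [a0 aE] b [b0 bE]].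
- by rewrite /= subrr mul0r.
- rewrite /value0 /=; case: (eqVneq q 0%N) => [->|q0]; rewrite /eval /=.
    by rewrite invr0 mulr0 subrr mul0r.
  by rewrite lt0n.
- have a0' : (value0 a).2.2%:R != 0 :> R by rewrite pnatr_eq0 -lt0n.
  have b0' : (value0 b).2.2%:R != 0 :> R by rewrite pnatr_eq0 -lt0n.
  split; first by rewrite /= muln_gt0 a0.
  rewrite evalD aE bE [value0 (Add a b)]/= -/(value0 a) -/(value0 b) /= !natrD !natrM.
  by field; rewrite a0' b0'.
- have a0' : (value0 a).2.2%:R != 0 :> R by rewrite pnatr_eq0 -lt0n.
  have b0' : (value0 b).2.2%:R != 0 :> R by rewrite pnatr_eq0 -lt0n.
  split; first by rewrite /= muln_gt0 a0.
  rewrite evalM aE bE [value0 (Mul a b)]/= -/(value0 a) -/(value0 b) /= !natrD !natrM.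
  by field; rewrite a0' b0'.
Qed.

(** At the zero valuation every expression is a rational number, so signs come from integer
    arithmetic; sentences may be tested there because their truth is the same at all valuations. *)
Lemma sat0 D : sat (fun _ => 0 : R) D = holds0 D.
Proof.
apply: dnf_eval_eq => e _; have [q0 ->] := value0P e; rewrite /sign0.
have q0' : 0 < (value0 e).2.2%:R^-1 :> R by rewrite invr_gt0 ltr0n.
rewrite mulrC sgn_pmul //; case: ltngtP => h.
- by rewrite sgn_pos ?subr_gt0 ?ltr_nat.
- by rewrite sgn_neg ?subr_lt0 ?ltr_nat.
- by rewrite h subrr sgn0.
Qed.

End FormulaSat.

Local Open Scope classical_set_scope.

(** * Least fixpoints and prefixpoints *)

Section LeastFixpoint.
Variables (R : realType) (G : game_structure R).
Implicit Types (d : state G -> state G -> R) (s t : state G).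
Variable H : (state G -> state G -> R) -> state G -> state G -> R.

Definition nonneg d : Prop := forall s t, 0 <= d s t.
(** Asking for nonnegativity alone keeps the triangle inequality out of the formulas; the least
    prefixpoint is a fixpoint, hence a value of [H], and [H_metric] makes it a directed metric. *)
Definition prefixpoint d : Prop := nonneg d /\ forall s t, H d s t <= d s t.

Hypothesis H_metric : forall d, nonneg d -> directed_metric (H d).
Hypothesis H_le1 : forall d, nonneg d -> forall s t, H d s t <= 1.
Hypothesis H_mono : forall d d', nonneg d -> (forall s t, d s t <= d' s t) ->
  forall s t, H d s t <= H d' s t.

Let least s t : R := inf [set d s t | d in prefixpoint].

Lemma prefixpoint1 : prefixpoint (fun _ _ => 1).
Proof. by split=> [s t|s t]; [exact: ler01|exact: H_le1]. Qed.

Lemma least_le d s t : prefixpoint d -> least s t <= d s t.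
Proof.
by move=> pd; apply: ge_inf; [exists 0 => _ [d' [d0 _] <-]|exists d].
Qed.

Lemma le_least (x : R) s t : (forall d, prefixpoint d -> x <= d s t) -> x <= least s t.
Proof.
move=> hx; apply: lb_le_inf; first by exists 1, (fun _ _ => 1) => //; exact: prefixpoint1.
by move=> _ [d pd <-]; exact: hx.
Qed.

Lemma least_nonneg : nonneg least.
Proof. by move=> s t; apply: le_least => d []. Qed.

Lemma least_prefixpoint : prefixpoint least.
Proof.
split; first exact: least_nonneg.
move=> s t; apply: le_least => d pd; apply: le_trans (proj2 pd s t).
by apply: H_mono least_nonneg _ _ _ => s' t'; exact: least_le.
Qed.

(** Knaster-Tarski: by monotonicity [H least] is a prefixpoint too, hence lies above [least]. *)
Lemma least_fixpoint_least : least_fixpoint H least.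
Proof.
have fixl s t : H least s t = least s t.
  apply/eqP; rewrite eq_le (proj2 least_prefixpoint) /=; apply: least_le; split.
    by have [] := H_metric least_nonneg.
  apply: H_mono; last exact: (proj2 least_prefixpoint).
  by have [] := H_metric least_nonneg.
have lE : H least = least by apply/funext => s; apply/funext => t.
split=> // [|d [d0 _ _] fd s t]; first by rewrite -lE; apply: H_metric least_nonneg.
by apply: least_le; split=> // s' t'; rewrite fd.
Qed.

Lemma lfpE : lfp H = least.
Proof.
have [m f l'] := least_fixpoint_least.
have := xgetPex (fun _ _ : state G => 0 : R) (ex_intro _ _ least_fixpoint_least).
rewrite -/(lfp H) => -[xm xf xl]; apply/funext => s; apply/funext => t.
by apply/eqP; rewrite eq_le xl // l'.
Qed.

(** The infimum of the prefixpoints is one of them and serves as the witness. *)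
Lemma lfp_leP s t (c : R) : lfp H s t <= c <-> exists2 d, prefixpoint d & d s t <= c.
Proof.
rewrite lfpE; split=> [lc|[d pd]]; first by exists least => //; exact: least_prefixpoint.
by apply: le_trans; exact: least_le.
Qed.

Lemma lfp_ltP s t (c : R) : lfp H s t < c <-> exists2 d, prefixpoint d & d s t < c.
Proof.
rewrite lfpE; split=> [lc|[d pd]]; first by exists least => //; exact: least_prefixpoint.
by apply: le_lt_trans; exact: least_le.
Qed.

Lemma lfp_ge0 s t : 0 <= lfp H s t.
Proof. by rewrite lfpE; exact: least_nonneg. Qed.

End LeastFixpoint.

(** * The one-step value operator and the metric transformers *)

Section Metrics.
Variables (R : realType) (G : game_structure R).
Implicit Types (d : state G -> state G -> R) (s t u : state G) (k : state G -> R)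
  (x y : move G -> R) (a b : move G).

Lemma distr_avg (T : finType) (p f : T -> R) (A : {set T}) : is_distr_on A p ->
  forall m : R, ((forall i, i \in A -> m <= f i) -> m <= \sum_i p i * f i) /\
    ((forall i, i \in A -> f i <= m) -> \sum_i p i * f i <= m).
Proof.
move=> [[p0 p1] pA] m.
have -> : m = \sum_i p i * m by rewrite -mulr_suml p1 mul1r.
split=> h; apply: ler_sum => i _; (have [iA|iA] := boolP (i \in A);
  [apply: ler_wpM2l => //; have := h i iA; by rewrite -mulr_suml p1 mul1r|by rewrite pA // !mul0r]).
Qed.

(** The sums are nested in the order in which [expE] writes them. *)
Definition expect_pure s x b k : R := \sum_u \sum_a delta G s a b u * x a * k u.

Lemma expectE s x y k : expect s x y k = \sum_b y b * expect_pure s x b k.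
Proof.
rewrite /expect /delta_mixed /expect_pure.
under [RHS]eq_bigr do rewrite mulr_sumr.
rewrite [RHS]exchange_big /=; apply: eq_bigr => u _.
rewrite exchange_big mulr_suml; apply: eq_bigr => b _.
rewrite mulr_suml mulr_sumr; apply: eq_bigr => a _; ring.
Qed.

Lemma expect_pure_itv s x b k : valuation k -> mixed_move player1 s x ->
  0 <= expect_pure s x b k <= 1.
Proof.
move=> kv xm.
have -> : expect_pure s x b k = \sum_a x a * \sum_u delta G s a b u * k u.
  rewrite /expect_pure exchange_big; apply: eq_bigr => a _; rewrite mulr_sumr.
  by apply: eq_bigr => u _; ring.
have H a : 0 <= \sum_u delta G s a b u * k u <= 1.
  have [d0 d1] := delta_distr s a b.
  have dT : is_distr_on [set: state G]%SET (delta G s a b).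
    by split=> // u; rewrite finset.in_setT.
  apply/andP; split.
    by apply: (proj1 (distr_avg k dT 0)) => u _; case/andP: (kv u).
  by apply: (proj2 (distr_avg k dT 1)) => u _; case/andP: (kv u).
apply/andP; split.
  by apply: (proj1 (distr_avg _ xm 0)) => a _; case/andP: (H a).
by apply: (proj2 (distr_avg _ xm 1)) => a _; case/andP: (H a).
Qed.

Definition pure_move b : move G -> R := fun a => (a == b)%:R.

Lemma pure_moveP i s b : b \in avail G i s -> mixed_move i s (pure_move b).
Proof.
move=> bA; split=> [|a aA]; last first.
  by rewrite /pure_move; case: eqP => // ab; rewrite ab bA in aA.
split=> [a|]; first by rewrite ler0n.
by rewrite (bigD1 b) //= /pure_move eqxx big1 ?addr0 // => a /negbTE ->.
Qed.

Lemma expect_pureE s x b k : expect s x (pure_move b) k = expect_pure s x b k.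
Proof.
rewrite expectE (bigD1 b) //= /pure_move eqxx mul1r big1 ?addr0 // => a /negbTE ->.
by rewrite mul0r.
Qed.

Lemma mixed_move_ex i s : exists x, mixed_move i s x.
Proof.
have [b bA] := set0Pn _ (avail_neq0 (g := G) i s).
by exists (pure_move b); exact: pure_moveP.
Qed.

Lemma lt_guaranteeP s x k (w : R) : valuation k -> mixed_move player1 s x ->
  w < inf [set expect s x y k | y in mixed_move player2 s] <->
  forall b, b \in avail G player2 s -> w < expect_pure s x b k.
Proof.
move=> kv xm; split=> [wI b bA|wE].
  apply: lt_le_trans wI _; apply: ge_inf.
    exists 0 => _ [y ym <-]; rewrite expectE.
    by apply: (proj1 (distr_avg _ ym 0)) => a _; case/andP: (expect_pure_itv a kv xm).
  by exists (pure_move b); [exact: pure_moveP|exact: expect_pureE].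
have [b0 b0A] := set0Pn _ (avail_neq0 (g := G) player2 s).
(* A minimum over the finitely many available moves keeps the inequality strict below the
   infimum. *)
case: (arg_minP (fun b => expect_pure s x b k) b0A) => b bA bmin.
apply: lt_le_trans (wE b bA) _; apply: lb_le_inf.
  by have [y ym] := mixed_move_ex player2 s; exists (expect s x y k), y.
by move=> _ [y ym <-]; rewrite expectE; apply: (proj1 (distr_avg _ ym _)) => a aA; exact: bmin.
Qed.

Lemma guarantee_le1 s x k : valuation k -> mixed_move player1 s x ->
  inf [set expect s x y k | y in mixed_move player2 s] <= 1.
Proof.
move=> kv xm; rewrite leNgt; apply/negP => /(lt_guaranteeP _ kv xm) h.
have [b bA] := set0Pn _ (avail_neq0 (g := G) player2 s).
by have := h b bA; have /andP[_] := expect_pure_itv b kv xm; rewrite leNgt => /negP.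
Qed.

Lemma lt_PreP s k (w : R) : valuation k -> w < Pre player1 k s <->
  exists2 x, mixed_move player1 s x &
    forall b, b \in avail G player2 s -> w < expect_pure s x b k.
Proof.
move=> kv; split=> [wP|[x xm wx]].
  have [|_ [x xm <-] wx] := sup_gt _ wP.
    by have [x xm] := mixed_move_ex player1 s; eexists; exists x.
  by exists x => //; apply/lt_guaranteeP.
apply: lt_le_trans (_ : inf [set expect s x y k | y in mixed_move player2 s] <= _).
  exact/lt_guaranteeP.
apply: ub_le_sup; last by exists x.
by exists 1 => _ [x' xm' <-]; exact: guarantee_le1.
Qed.

Lemma Pre_itv s k : valuation k -> 0 <= Pre player1 k s <= 1.
Proof.
move=> kv; apply/andP; split; rewrite leNgt; apply/negP.
  have [x xm] := mixed_move_ex player1 s.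
  (* A negative value would itself be a threshold below all expectations, and [lt_PreP] would place
     it strictly below itself. *)
  rewrite -subr_gt0 sub0r => P0; have : Pre player1 k s < Pre player1 k s; last by rewrite ltxx.
  apply/lt_PreP => //; exists x => // b _; have /andP[] := expect_pure_itv b kv xm; lra.
move=> /(lt_PreP _ _ kv)[x xm h]; have [b bA] := set0Pn _ (avail_neq0 (g := G) player2 s).
by have := h b bA; have /andP[_] := expect_pure_itv b kv xm; rewrite leNgt => /negP.
Qed.

(* The strict threshold [w] makes it unnecessary to know that the supremum in [Pre] is
   attained, and pure replies suffice because the expectation is affine in the reply. *)
Definition simulates d s t (r : R) : Prop :=
  forall k, Lip d k -> forall (w : R) x, mixed_move player1 s x ->
    (forall b, b \in avail G player2 s -> w < expect_pure s x b k) ->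
  exists2 y, mixed_move player1 t y &
    forall b, b \in avail G player2 t -> w - r < expect_pure t y b k.

(** For the bound on [Pre], the threshold is [r + Pre player1 k t]: were it below the value at [s],
    lowering it by [r] would put the value at [t] strictly below itself. *)
Lemma simulatesP d s t r :
  simulates d s t r <-> forall k, Lip d k -> Pre player1 k s - Pre player1 k t <= r.
Proof.
split=> [sim k kd|H k kd w x xm wx].
  have kv := proj1 kd; rewrite lerBlDr leNgt; apply/negP => h.
  have /(lt_PreP _ _ kv)[x xm wx] := h; have := sim k kd _ x xm wx.
  by move/(lt_PreP _ _ kv); rewrite addrC addKr ltxx.
have kv := proj1 kd; apply/(lt_PreP _ _ kv).
have : w < Pre player1 k s by apply/(lt_PreP _ _ kv); exists x.
by have := H k kd; lra.
Qed.

(** Keeps the set under the supremum in [Hsim] nonempty. *)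
Lemma Lip0 d : nonneg d -> Lip d (fun _ => 0).
Proof. by move=> d0; split=> [s|s t]; rewrite ?lexx ?ler01 // subrr. Qed.

Lemma Hsim_leP d s t (r : R) : nonneg d ->
  Hsim player1 d s t <= r <-> obs_dist s t <= r /\ simulates d s t r.
Proof.
move=> d0; rewrite /Hsim ge_max; split=> [/andP[-> h]|[-> /simulatesP h]] /=.
  split=> //; apply/simulatesP => k kd; apply: le_trans h; apply: ub_le_sup; last by exists k.
  exists 1 => _ [k' [kv' _] <-].
  by have /andP[? ?] := Pre_itv s kv'; have /andP[? ?] := Pre_itv t kv'; lra.
apply: ge_sup; last by move=> _ [k kd <-]; exact: h.
exists (Pre player1 (fun _ => 0) s - Pre player1 (fun _ => 0) t), (fun _ => 0) => //.
exact: Lip0.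
Qed.

(** The bound [0 <= r] accounts for the default 0 of the maximum when there are no observation
    variables. *)
Lemma obs_dist_leP s t (r : R) : 0 <= r ->
  obs_dist s t <= r <-> forall v, `|obs G v s - obs G v t| <= r.
Proof.
move=> r0; split=> [h v|h]; last by apply: bigmax_le.
by apply: le_trans h; exact: (le_bigmax _ (fun v => `|obs G v s - obs G v t|)).
Qed.

Lemma obs_dist_ge0 s t : 0 <= obs_dist s t.
Proof. exact: bigmax_ge_id. Qed.

Lemma obs_dist_le1 s t : obs_dist s t <= 1.
Proof.
apply/obs_dist_leP => // v; have /andP[? ?] := obs_itv v s; have /andP[? ?] := obs_itv v t.
by rewrite ler_norml; lra.
Qed.

Lemma obs_dist_triangle s t u : obs_dist s u <= obs_dist s t + obs_dist t u.
Proof.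
apply/obs_dist_leP => [|v]; first by rewrite addr_ge0 // obs_dist_ge0.
apply: le_trans (ler_distD (obs G v t) _ _) _; apply: lerD.
  by have /obs_dist_leP := lexx (obs_dist s t); apply; exact: obs_dist_ge0.
by have /obs_dist_leP := lexx (obs_dist t u); apply; exact: obs_dist_ge0.
Qed.

Lemma Hsim_ge0 d s t : 0 <= Hsim player1 d s t.
Proof. by rewrite /Hsim le_max obs_dist_ge0. Qed.

(** For each fixed [k] the differences telescope, whence the triangle inequality for any nonnegative
    [d]. *)
Lemma Hsim_metric d : nonneg d -> directed_metric (Hsim player1 d).
Proof.
move=> d0; split; first exact: Hsim_ge0.
  move=> s; apply/eqP; rewrite eq_le Hsim_ge0 andbT; apply/Hsim_leP => //; split.
    by apply/obs_dist_leP => // v; rewrite subrr normr0.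
  by apply/simulatesP => k _; rewrite subrr.
move=> s t u; apply/Hsim_leP => //.
have /(Hsim_leP _ _ _ d0)[o1 /simulatesP s1] := lexx (Hsim player1 d s t).
have /(Hsim_leP _ _ _ d0)[o2 /simulatesP s2] := lexx (Hsim player1 d t u).
split; first by apply: le_trans (obs_dist_triangle s t u) _; exact: lerD.
by apply/simulatesP => k kd; have := s1 k kd; have := s2 k kd; lra.
Qed.

Lemma Hsim_le1 d : nonneg d -> forall s t, Hsim player1 d s t <= 1.
Proof.
move=> d0 s t; apply/Hsim_leP => //; split; first exact: obs_dist_le1.
apply/simulatesP => k [kv _].
by have /andP[? ?] := Pre_itv s kv; have /andP[? ?] := Pre_itv t kv; lra.
Qed.

Lemma Hsim_mono d d' : nonneg d -> (forall s t, d s t <= d' s t) ->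
  forall s t, Hsim player1 d s t <= Hsim player1 d' s t.
Proof.
move=> d0 dd' s t; have d0' : nonneg d' by move=> s' t'; apply: le_trans (dd' _ _).
have /(Hsim_leP _ _ _ d0')[o1 /simulatesP s1] := lexx (Hsim player1 d' s t).
apply/Hsim_leP => //; split=> //; apply/simulatesP => k [kv kd]; apply: s1; split=> // s' t'.
exact: le_trans (dd' _ _).
Qed.

Lemma Hbisim_metric d : nonneg d -> directed_metric (Hbisim player1 d).
Proof.
move=> /Hsim_metric[h0 hs ht]; rewrite /Hbisim /metric_join /converse; split.
- by move=> s t; rewrite le_max h0.
- by move=> s; rewrite hs maxxx.
- move=> s t u; rewrite ge_max; apply/andP; split.
    apply: le_trans (ht s t u) _; apply: lerD; by rewrite le_max lexx.
  apply: le_trans (ht u t s) _; rewrite addrC; apply: lerD; by rewrite le_max lexx orbT.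
Qed.

Lemma Hbisim_le1 d : nonneg d -> forall s t, Hbisim player1 d s t <= 1.
Proof. by move=> d0 s t; rewrite ge_max /converse !Hsim_le1. Qed.

Lemma Hbisim_mono d d' : nonneg d -> (forall s t, d s t <= d' s t) ->
  forall s t, Hbisim player1 d s t <= Hbisim player1 d' s t.
Proof.
move=> d0 dd' s t; rewrite /Hbisim /metric_join /converse ge_max; apply/andP; split.
  by apply: le_trans (Hsim_mono d0 dd' s t) _; rewrite le_max lexx.
by apply: le_trans (Hsim_mono d0 dd' t s) _; rewrite le_max lexx orbT.
Qed.

(** The clause under [bis] is the converse half of [Hbisim], transposed; the observation part of
    that half follows from the symmetry of the absolute value. *)
Definition simulation_metric (bis : bool) d : Prop :=
  nonneg d /\ forall s t, [/\ forall v, `|obs G v s - obs G v t| <= d s t,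
    simulates d s t (d s t) & bis -> simulates d s t (d t s)].

Lemma prefixpoint_simP d : prefixpoint (Hsim player1) d <-> simulation_metric false d.
Proof.
split=> -[d0 h]; split=> // s t.
  by have /(Hsim_leP _ _ _ d0)[/obs_dist_leP o sm] := h s t; split=> //; apply: o.
by have [o sm _] := h s t; apply/Hsim_leP => //; split=> //; apply/obs_dist_leP.
Qed.

Lemma prefixpoint_bisimP d : prefixpoint (Hbisim player1) d <-> simulation_metric true d.
Proof.
split=> -[d0 h]; split=> // s t.
  have := h s t; rewrite ge_max => /andP[/(Hsim_leP _ _ _ d0)[/obs_dist_leP o sm] _].
  have := h t s; rewrite ge_max => /andP[_ /(Hsim_leP _ _ _ d0)[_ sm']].
  by split=> //; apply: o.
have [o sm _] := h s t; have [o' _ sm'] := h t s.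
rewrite ge_max; apply/andP; split; apply/Hsim_leP => //; split=> //; last exact: sm'.
  exact/obs_dist_leP.
by apply/obs_dist_leP => // v; rewrite distrC.
Qed.

Definition game_dist (bis : bool) : state G -> state G -> R :=
  if bis then game_bisim_dist (G := G) else sim_dist player1.

Lemma game_dist_leP bis s t (c : R) :
  game_dist bis s t <= c <-> exists2 d, simulation_metric bis d & d s t <= c.
Proof.
case: bis; rewrite /game_dist.
  rewrite (lfp_leP Hbisim_metric Hbisim_le1 Hbisim_mono).
  by split=> -[d pd dc]; exists d => //; apply/prefixpoint_bisimP.
rewrite (lfp_leP Hsim_metric Hsim_le1 Hsim_mono).
by split=> -[d pd dc]; exists d => //; apply/prefixpoint_simP.
Qed.

Lemma game_dist_ltP bis s t (c : R) :
  game_dist bis s t < c <-> exists2 d, simulation_metric bis d & d s t < c.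
Proof.
case: bis; rewrite /game_dist.
  rewrite (lfp_ltP Hbisim_metric Hbisim_le1 Hbisim_mono).
  by split=> -[d pd dc]; exists d => //; apply/prefixpoint_bisimP.
rewrite (lfp_ltP Hsim_metric Hsim_le1 Hsim_mono).
by split=> -[d pd dc]; exists d => //; apply/prefixpoint_simP.
Qed.

Lemma game_dist_ge0 bis s t : 0 <= game_dist bis s t.
Proof.
case: bis; first exact: (lfp_ge0 Hbisim_metric Hbisim_le1 Hbisim_mono).
exact: (lfp_ge0 Hsim_metric Hsim_le1 Hsim_mono).
Qed.

End Metrics.

(** * The first-order definition of the distances, read off the code of a game *)

(** Inverts [code_rat]: an even numerator code [2n] stands for [n], an odd one [2n + 1] for
    [-(n + 1)]. *)
Definition ratE (l : seq nat) (i : nat) : expr :=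
  if (nth 0 l i %% 2 == 0)%N then Cst (nth 0 l i %/ 2) 0 (nth 0 l i.+1)
  else Cst 0 (nth 0 l i %/ 2).+1 (nth 0 l i.+1).

Section GameFormula.
Variable g : seq nat.
Local Open Scope nat_scope.

Definition gN : nat := nth 0 g 0.
Definition gO : nat := nth 0 g 1.
Definition gM : nat := nth 0 g 2.
(** Offsets here and below follow [code_game]: three cardinals, then the tables, with two entries
    per rational and one per membership bit. In [gavail], [i] is 0 for player 1 and 1 for player
    2. *)
Definition obsE (v s : nat) : expr := ratE g (3 + 2 * (v * gN + s)).
Definition gavail (i s a : nat) : bool :=
  nth 0 g (3 + (2 * (gO * gN) + (i * (gN * gM) + (s * gM + a)))) == 1.
Definition deltaE (s a b u : nat) : expr :=
  ratE g (3 + (2 * (gO * gN) + (2 * (gN * gM) + 2 * (((s * gM + a) * gM + b) * gN + u)))).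

(** The first component is a tag that keeps the five kinds of variables apart. *)
Definition var_d (s t : nat) : nat := pcons 0 (pcons s t).
Definition var_k (u : nat) : nat := pcons 1 u.
Definition var_w : nat := pcons 2 0.
Definition var_x (a : nat) : nat := pcons 3 a.
Definition var_y (a : nat) : nat := pcons 4 a.

(* [tag] is 3 for the mixed move [x] and 4 for the mixed move [y]. *)
Definition expE (tag s b : nat) : expr :=
  sumE gN (fun u => sumE gM (fun a =>
    Mul (Mul (deltaE s a b u) (Var (pcons tag a))) (Var (var_k u)))).
Definition mixedF (tag s : nat) : dnf :=
  qe_and (qe_conj gM (fun a => qe_and (qe_le zeroE (Var (pcons tag a)))
            (if gavail 0 s a then qe_true else qe_eq (Var (pcons tag a)) zeroE)))
    (qe_eq (sumE gM (fun a => Var (pcons tag a))) oneE).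
Definition guaranteeF (tag s : nat) (w : expr) : dnf :=
  qe_conj gM (fun b => if gavail 1 s b then qe_lt w (expE tag s b) else qe_true).
Definition lipF : dnf :=
  qe_conj gN (fun s => qe_and
    (qe_and (qe_le zeroE (Var (var_k s))) (qe_le (Var (var_k s)) oneE))
    (qe_conj gN (fun t =>
       qe_le (subE (Var (var_k s)) (Var (var_k t))) (Var (var_d s t))))).
(** [r] is the index of a variable, not a number: the slack is itself one of the unknown
    distances. *)
Definition simulatesF (s t r : nat) : dnf :=
  qe_foralls (map var_k (iota 0 gN)) (qe_imp lipF
   (qe_foralls [:: var_w] (qe_foralls (map var_x (iota 0 gM))
     (qe_imp (qe_and (mixedF 3 s) (guaranteeF 3 s (Var var_w)))
       (qe_exs (map var_y (iota 0 gM))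
         (qe_and (mixedF 4 t) (guaranteeF 4 t (subE (Var var_w) (Var r))))))))).
Definition obsF (s t : nat) : dnf :=
  qe_conj gO (fun v => qe_and (qe_le (subE (obsE v s) (obsE v t)) (Var (var_d s t)))
    (qe_le (subE (obsE v t) (obsE v s)) (Var (var_d s t)))).
Definition metricF (bis : bool) : dnf :=
  qe_conj gN (fun s => qe_conj gN (fun t =>
    qe_and (qe_le zeroE (Var (var_d s t)))
      (qe_and (obsF s t) (qe_and (simulatesF s t (var_d s t))
        (if bis then simulatesF s t (var_d t s) else qe_true))))).
Definition var_ds : seq nat :=
  flatten [seq [seq var_d s t | t <- iota 0 gN] | s <- iota 0 gN].
Definition distF (bis strict : bool) (s t : nat) (c : expr) : dnf :=
  qe_exs var_ds (qe_and (metricF bis)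
    (if strict then qe_lt (Var (var_d s t)) c else qe_le (Var (var_d s t)) c)).

End GameFormula.

#[export] Instance ratE_computable : Computable2 ratE.
Proof. by rewrite /ratE; computability. Qed.

#[export] Instance gN_computable : Computable1 gN.
Proof. by rewrite /gN; computability. Qed.

#[export] Instance gO_computable : Computable1 gO.
Proof. by rewrite /gO; computability. Qed.

#[export] Instance gM_computable : Computable1 gM.
Proof. by rewrite /gM; computability. Qed.

#[export] Instance obsE_computable : Computable3 obsE.
Proof. by rewrite /obsE; computability. Qed.

#[export] Instance gavail_computable : Computable4 gavail.
Proof. by rewrite /gavail; computability. Qed.

#[export] Instance expE_computable : Computable4 expE.
Proof. by rewrite /expE /deltaE /var_k; computability. Qed.

#[export] Instance mixedF_computable : Computable3 mixedF.
Proof. by rewrite /mixedF; computability. Qed.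

#[export] Instance guaranteeF_computable : Computable4 guaranteeF.
Proof. by rewrite /guaranteeF; computability. Qed.

#[export] Instance lipF_computable : Computable1 lipF.
Proof. by rewrite /lipF /var_k /var_d; computability. Qed.

#[export] Instance simulatesF_computable : Computable4 simulatesF.
Proof. by rewrite /simulatesF /var_k /var_x /var_y; computability. Qed.

#[export] Instance obsF_computable : Computable3 obsF.
Proof. by rewrite /obsF /var_d; computability. Qed.

#[export] Instance metricF_computable : Computable2 metricF.
Proof. by rewrite /metricF /var_d; computability. Qed.

#[export] Instance var_ds_computable : Computable1 var_ds.
Proof. by rewrite /var_ds /var_d; computability. Qed.

(** * Reading the tables of a coded game *)

Lemma size_flatten_const (T : Type) (c : nat) (ss : seq (seq T)) :
  all (fun s => size s == c) ss -> size (flatten ss) = (size ss * c)%N.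
Proof.
by elim: ss => //= s ss IHss /andP[/eqP sc ssc]; rewrite size_cat IHss // sc mulSn.
Qed.

Lemma nth_flatten_const (T : Type) (x0 : T) (c : nat) (ss : seq (seq T)) i j :
  all (fun s => size s == c) ss -> (i < size ss)%N -> (j < c)%N ->
  nth x0 (flatten ss) (i * c + j) = nth x0 (nth [::] ss i) j.
Proof.
move=> + + jc; elim: ss i => //= s ss IHss i /andP[/eqP sc ssc] ic.
rewrite nth_cat sc; case: i ic => [_|i ic]; first by rewrite mul0n add0n jc.
by rewrite mulSn -addnA ltnNge leq_addr /= addKn; apply: IHss.
Qed.

Lemma all_size_map (T U : Type) (c : nat) (f : T -> seq U) s :
  (forall x, size (f x) = c) -> all (fun s => size s == c) [seq f x | x <- s].
Proof. by move=> fc; elim: s => //= x s ->; rewrite fc eqxx. Qed.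

Lemma nth_allpairs (T U V : Type) (x0 : T) (y0 : U) (z0 : V) (f : T -> U -> V) s t i j :
  (i < size s)%N -> (j < size t)%N ->
  nth z0 [seq f x y | x <- s, y <- t] (i * size t + j) = f (nth x0 s i) (nth y0 t j).
Proof.
move=> si tj; rewrite nth_flatten_const ?size_map //.
  by rewrite (nth_map x0) // (nth_map y0).
by apply: all_size_map => x; rewrite size_map.
Qed.

Lemma ltn_mulD i j m n : (i < m -> j < n -> i * n + j < m * n)%N.
Proof.
move=> im jn; apply: (@leq_trans (i.+1 * n)); last by rewrite leq_mul2r im orbT.
by rewrite mulSn addnC ltn_add2r.
Qed.

Lemma all_size_allpairs (T U : Type) (f : T -> U -> rat) s t :
  all (fun r => size r == 2%N) [seq code_rat (f x y) | x <- s, y <- t].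
Proof.
elim: s => //= x s IHs; rewrite all_cat IHs andbT.
by apply: all_size_map => y.
Qed.

Section Tables.
Variable G : game_structure rat.
Local Open Scope nat_scope.
Implicit Types (s u : state G) (v : obs_var G) (a b : move G).

Let N := #|state G|.
Let O := #|obs_var G|.
Let M := #|move G|.
Let g := code_game G.
Let obs_tab :=
  flatten [seq code_rat (obs G v s) | v <- enum (obs_var G), s <- enum (state G)].
Let avail_tab i :=
  [seq nat_of_bool (a \in avail G i s) | s <- enum (state G), a <- enum (move G)].
Let pairs := [seq (a1, a2) | a1 <- enum (move G), a2 <- enum (move G)].
Let delta_rows s := [seq code_rat (delta G s ab.1 ab.2 u) | ab <- pairs, u <- enum (state G)].
Let delta_tab := flatten [seq flatten (delta_rows s) | s <- enum (state G)].

Lemma gN_code : gN g = N. Proof. by []. Qed.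
Lemma gO_code : gO g = O. Proof. by []. Qed.
Lemma gM_code : gM g = M. Proof. by []. Qed.

Lemma code_gameE i : nth 0 g (3 + i) =
  nth 0 (obs_tab ++ avail_tab player1 ++ avail_tab player2 ++ delta_tab) i.
Proof. by []. Qed.

Lemma size_enum (T : finType) : size (enum T) = #|T|.
Proof. by rewrite cardE. Qed.

Lemma size_obs_tab : size obs_tab = 2 * (O * N).
Proof.
rewrite (size_flatten_const (c := 2)) ?all_size_allpairs //.
by rewrite size_allpairs !size_enum mulnC.
Qed.

Lemma size_avail_tab i : size (avail_tab i) = N * M.
Proof. by rewrite size_allpairs !size_enum. Qed.

Lemma size_delta_rows s : size (delta_rows s) = M * M * N.
Proof. by rewrite !size_allpairs !size_enum. Qed.

Lemma nth_obs_tab v s e : e < 2 ->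
  nth 0 obs_tab (2 * (enum_rank v * N + enum_rank s) + e) = nth 0 (code_rat (obs G v s)) e.
Proof.
move=> e2; have vO : enum_rank v < O by []; have sN : enum_rank s < N by [].
rewrite mulnC nth_flatten_const ?all_size_allpairs //; last first.
  by rewrite size_allpairs !size_enum; exact: ltn_mulD.
have := nth_allpairs v s [::] (fun v s => code_rat (obs G v s))
  (s := enum (obs_var G)) (t := enum (state G)) (i := enum_rank v) (j := enum_rank s).
by rewrite !size_enum !nth_enum_rank => ->.
Qed.

Lemma nth_avail_tab i s a :
  nth 0 (avail_tab i) (enum_rank s * M + enum_rank a) = (a \in avail G i s).
Proof.
have sN : enum_rank s < N by []; have aM : enum_rank a < M by [].
have := nth_allpairs s a 0 (fun s a => nat_of_bool (a \in avail G i s))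
  (s := enum (state G)) (t := enum (move G)) (i := enum_rank s) (j := enum_rank a).
by rewrite !size_enum !nth_enum_rank => ->.
Qed.

Lemma nth_delta_tab s a b u e : e < 2 ->
  nth 0 delta_tab (2 * (((enum_rank s * M + enum_rank a) * M + enum_rank b) * N + enum_rank u) + e)
  = nth 0 (code_rat (delta G s a b u)) e.
Proof.
move=> e2; have sN : enum_rank s < N by []; have aM : enum_rank a < M by [].
have bM : enum_rank b < M by []; have uN : enum_rank u < N by [].
set i := (enum_rank a * M + enum_rank b) * N + enum_rank u.
have iM : enum_rank a * M + enum_rank b < M * M by exact: ltn_mulD.
have iN : i < M * M * N by exact: ltn_mulD.
(* Each state owns a block of [M * M * N * 2] entries, inside which [i] counts the rationals. *)
have -> : 2 * (((enum_rank s * M + enum_rank a) * M + enum_rank b) * N + enum_rank u) + e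
   = enum_rank s * (M * M * N * 2) + (i * 2 + e) by rewrite /i; ring.
rewrite nth_flatten_const; first last.
- by lia.
- by rewrite size_map size_enum.
- apply: all_size_map => s'; rewrite (size_flatten_const (c := 2)) ?all_size_allpairs //.
  by rewrite size_delta_rows.
rewrite (nth_map s) ?size_enum // nth_enum_rank nth_flatten_const ?all_size_allpairs //; last first.
  by rewrite size_delta_rows.
have := nth_allpairs (a, a) u [::] (fun ab u => code_rat (delta G s ab.1 ab.2 u))
  (s := pairs) (t := enum (state G)) (i := enum_rank a * M + enum_rank b) (j := enum_rank u).
rewrite size_allpairs !size_enum => -> //.
have := nth_allpairs a a (a, a) (fun a b => (a, b))
  (s := enum (move G)) (t := enum (move G)) (i := enum_rank a) (j := enum_rank b).
by rewrite !size_enum !nth_enum_rank => ->.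
Qed.

Lemma nth_code_obs v s e : e < 2 ->
  nth 0 g (3 + 2 * (enum_rank v * N + enum_rank s) + e) = nth 0 (code_rat (obs G v s)) e.
Proof.
move=> e2; have vO : enum_rank v < O by []; have sN : enum_rank s < N by [].
rewrite -addnA code_gameE nth_cat size_obs_tab nth_obs_tab //.
by rewrite ![2 * _]mulnC ltn_mulD // ltn_mulD.
Qed.

Lemma gavail1_code s a : gavail g 0 (enum_rank s) (enum_rank a) = (a \in avail G player1 s).
Proof.
have sN : enum_rank s < N by []; have aM : enum_rank a < M by [].
rewrite /gavail gN_code gO_code gM_code code_gameE nth_cat size_obs_tab ltnNge leq_addr /= addKn.
rewrite mul0n add0n nth_cat size_avail_tab.
rewrite ltn_mulD //.
by rewrite nth_avail_tab eqb1.
Qed.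

Lemma gavail2_code s a : gavail g 1 (enum_rank s) (enum_rank a) = (a \in avail G player2 s).
Proof.
have sN : enum_rank s < N by []; have aM : enum_rank a < M by [].
rewrite /gavail gN_code gO_code gM_code code_gameE nth_cat size_obs_tab ltnNge leq_addr /= addKn.
rewrite mul1n nth_cat size_avail_tab ltnNge leq_addr /= addKn nth_cat size_avail_tab.
rewrite ltn_mulD //.
by rewrite nth_avail_tab eqb1.
Qed.

Lemma nth_code_delta s a b u e : e < 2 ->
  nth 0 g (3 + (2 * (O * N) + (2 * (N * M) +
     2 * (((enum_rank s * M + enum_rank a) * M + enum_rank b) * N + enum_rank u))) + e)
  = nth 0 (code_rat (delta G s a b u)) e.
Proof.
move=> e2; set i := 2 * (((_ + _) * _ + _) * _ + _).
have -> : 3 + (2 * (O * N) + (2 * (N * M) + i)) + e =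
   3 + (2 * (O * N) + (N * M + (N * M + (i + e)))) by ring.
rewrite code_gameE nth_cat size_obs_tab ltnNge leq_addr /= addKn.
rewrite nth_cat size_avail_tab ltnNge leq_addr /= addKn.
by rewrite nth_cat size_avail_tab ltnNge leq_addr /= addKn nth_delta_tab.
Qed.

End Tables.

Lemma eval_ratE (R : realType) (rho : nat -> R) l i q :
  nth 0%N l i = code_int (numq q) -> nth 0%N l i.+1 = `|denq q|%N -> eval rho (ratE l i) = ratr q.
Proof.
move=> e1 e2; rewrite /ratE e1 e2 /ratr.
have -> : (denq q)%:~R = `|denq q|%N%:R :> R by rewrite -[in LHS](gez0_abs (ltW (denq_gt0 q))).
case: (numq q) => n /=.
  by rewrite -muln2 modnMl mulnK // /eval /= subr0.
rewrite -muln2 -addn1 modnMDl divnMDl // addn0 /eval /= sub0r.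
by rewrite NegzE mulrNz.
Qed.

Lemma all_iotaP (T : finType) (P : pred nat) :
  reflect (forall x : T, P (enum_rank x)) (all P (iota 0 #|T|)).
Proof.
apply: (iffP allP) => [H x|H i]; first by apply: H; rewrite mem_iota /=.
by rewrite mem_iota /= => iT; rewrite -[i]/(nat_of_ord (Ordinal iT)) -[Ordinal iT]enum_valK.
Qed.

Lemma eval_sumE_rank (R : rcfType) (rho : nat -> R) (T : finType) (f : nat -> expr) :
  eval rho (sumE #|T| f) = \sum_(x : T) eval rho (f (enum_rank x)).
Proof.
by rewrite eval_sumE (reindex (@enum_rank T)) //; exact: onW_bij (enum_rank_bij T).
Qed.

Lemma mem_map_iota (T : finType) (v : nat -> nat) :
  map v (iota 0 #|T|) =i codom (fun x : T => v (enum_rank x)).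
Proof.
move=> n; apply/mapP/codomP => [[i]|[x ->]]; last first.
  by exists (nat_of_ord (enum_rank x)); rewrite ?mem_iota /=.
by rewrite mem_iota /= => iT ->; exists (enum_val (Ordinal iT)); rewrite enum_valK.
Qed.

(** * Meaning of the formulas at the code of a game *)

Section Correctness.
Variables (R : realType) (G : game_structure rat).
Local Notation RG := (real_game R G).
Local Notation g := (code_game G).
Implicit Types (rho : nat -> R) (s t u : state G) (a b : move G) (tag : nat).

Lemma eval_obsE rho v s : eval rho (obsE g (enum_rank v) (enum_rank s)) = obs RG v s.
Proof.
apply: eval_ratE; first by have := nth_code_obs v s (e := 0) isT; rewrite addn0.
by have := nth_code_obs v s (e := 1) isT; rewrite addn1.
Qed.

Lemma eval_deltaE rho s a b u :
  eval rho (deltaE g (enum_rank s) (enum_rank a) (enum_rank b) (enum_rank u)) = delta RG s a b u.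
Proof.
apply: eval_ratE; first by have := nth_code_delta s a b u (e := 0) isT; rewrite addn0.
by have := nth_code_delta s a b u (e := 1) isT; rewrite addn1.
Qed.

Definition dval rho : state RG -> state RG -> R :=
  fun s t => rho (var_d (enum_rank s) (enum_rank t)).
Definition kval rho : state RG -> R := fun u => rho (var_k (enum_rank u)).
Definition mval tag rho : move RG -> R := fun a => rho (pcons tag (enum_rank a)).

Lemma eval_expE rho tag s b : eval rho (expE g tag (enum_rank s) (enum_rank b)) =
  expect_pure (G := RG) s (mval tag rho) b (kval rho).
Proof.
rewrite /expE gN_code eval_sumE_rank; apply: eq_bigr => u _.
rewrite gM_code eval_sumE_rank; apply: eq_bigr => a _.
by rewrite !evalM eval_deltaE.
Qed.

Lemma sat_mixedF rho tag s : sat rho (mixedF g tag (enum_rank s)) <->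
  mixed_move (G := RG) player1 s (mval tag rho).
Proof.
rewrite sat_and sat_conj sat_eq eval_oneE gM_code eval_sumE_rank.
have atomE a : sat rho (qe_and (qe_le zeroE (Var (pcons tag (enum_rank a))))
    (if gavail g 0 (enum_rank s) (enum_rank a) then qe_true
     else qe_eq (Var (pcons tag (enum_rank a))) zeroE)) =
    (0 <= mval tag rho a) && ((a \notin avail G player1 s) ==> (mval tag rho a == 0)).
  by rewrite sat_and sat_le gavail1_code; case: ifP => aA; rewrite ?sat_eq eval_zeroE.
split=> [/andP[/all_iotaP H /eqP e]|[[H0 e] H]].
  have {}H a : 0 <= mval tag rho a /\ (a \notin avail G player1 s -> mval tag rho a = 0).
    by have := H a; rewrite atomE => /andP[? /implyP h]; split=> // /h /eqP.
  by split; [split=> // a; case: (H a)|move=> a /(proj2 (H a))].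
apply/andP; split; last exact/eqP.
apply/all_iotaP => a; rewrite atomE H0; apply/implyP => aA; apply/eqP; exact: H.
Qed.

Lemma sat_guaranteeF rho tag s w : sat rho (guaranteeF g tag (enum_rank s) w) <->
  forall b, b \in avail G player2 s ->
    eval rho w < expect_pure (G := RG) s (mval tag rho) b (kval rho).
Proof.
rewrite sat_conj gM_code.
have atomE b : sat rho (if gavail g 1 (enum_rank s) (enum_rank b)
     then qe_lt w (expE g tag (enum_rank s) (enum_rank b)) else qe_true) =
    ((b \in avail G player2 s) ==>
     (eval rho w < expect_pure (G := RG) s (mval tag rho) b (kval rho))).
  by rewrite gavail2_code; case: ifP => bA //; rewrite sat_lt eval_expE.
split=> [/all_iotaP H b bA|H]; first by have := H b; rewrite atomE bA.
by apply/all_iotaP => b; rewrite atomE; apply/implyP; exact: H.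
Qed.

Lemma sat_lipF rho : sat rho (lipF g) <-> Lip (G := RG) (dval rho) (kval rho).
Proof.
rewrite sat_conj gN_code; split=> [/all_iotaP H|[kv kd]].
  split=> [s|s t]; have := H s; rewrite !sat_and !sat_le eval_zeroE eval_oneE.
    by case/andP.
  by case/andP => _; rewrite sat_conj => /all_iotaP/(_ t); rewrite sat_le eval_subE.
apply/all_iotaP => s; rewrite !sat_and !sat_le eval_zeroE eval_oneE.
apply/andP; split; first exact: kv.
by rewrite sat_conj; apply/all_iotaP => t; rewrite sat_le eval_subE; exact: kd.
Qed.

Lemma var_inj (T : finType) tag : injective (fun x : T => pcons tag (enum_rank x)).
Proof. by move=> x y /pcons_inj[_ /ord_inj /enum_rank_inj]. Qed.

Lemma assign_tag (T : finType) tag (f : T -> R) rho tag' n : tag != tag' ->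
  assign (fun x : T => pcons tag (enum_rank x)) f rho (pcons tag' n) = rho (pcons tag' n).
Proof. by move=> /eqP ne; apply: assign_out => x /pcons_inj[]. Qed.

Lemma sat_simulatesF rho s t s' t' :
  sat rho (simulatesF g (enum_rank s) (enum_rank t) (var_d (enum_rank s') (enum_rank t'))) <->
  simulates (G := RG) (dval rho) s t (dval rho s' t').
Proof.
pose vk (u : state G) := var_k (enum_rank u).
(* The threshold is a block with a single variable, indexed by [unit]. *)
pose vw (_ : unit) := pcons 2 0.
pose vx (a : move G) := var_x (enum_rank a).
pose vy (a : move G) := var_y (enum_rank a).
have vk_inj : injective vk := @var_inj _ 1.
have vx_inj : injective vx := @var_inj _ 3.
have vy_inj : injective vy := @var_inj _ 4.
have vw_inj : injective vw by case; case.
have vwE : [:: var_w] =i codom vw.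
  move=> n; rewrite mem_seq1; apply/eqP/codomP => [->|[x ->]] //; by exists tt.
have key k rho1 : rho1 = assign vk k rho ->
   [/\ dval rho1 = dval rho & kval rho1 = k].
  move=> ->; split; apply/funext => u; last by rewrite /kval (assign_in _ _ _ vk_inj).
  by apply/funext => u'; rewrite /dval assign_tag.
have keyw (w : R) rho1 : dval (assign vw (fun _ => w) rho1) = dval rho1 /\
    kval (assign vw (fun _ => w) rho1) = kval rho1.
  split; apply/funext => u; last by rewrite /kval assign_out // => x /pcons_inj[].
  by apply/funext => u'; rewrite /dval assign_out // => x /pcons_inj[].
(* [2 < tag] separates the block of a mixed move from the distances, the valuation and the
   threshold, whose tags are 0, 1 and 2. *)
have keyx tag (x : move G -> R) rho1 : (2 < tag)%N ->
    let rho2 := assign (fun a => pcons tag (enum_rank a)) x rho1 in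
    [/\ dval rho2 = dval rho1, kval rho2 = kval rho1, mval tag rho2 = x &
        rho2 var_w = rho1 var_w].
  move=> tag2 rho2; rewrite /rho2; split.
  - by apply/funext => u; apply/funext => u'; rewrite /dval assign_tag //; lia.
  - by apply/funext => u; rewrite /kval assign_tag //; lia.
  - by apply/funext => a; rewrite /mval (assign_in _ _ _ (@var_inj _ tag)).
  - by rewrite assign_tag //; lia.
rewrite /simulatesF gN_code gM_code.
rewrite (sat_foralls_assign _ _ vk_inj (mem_map_iota _ var_k)).
split=> H k.
  move=> kd w x xm wx; set rho1 := assign vk k rho; have [d1 k1] := key k rho1 erefl.
  have lip1 : sat rho1 (lipF g) by apply/sat_lipF; rewrite d1 k1.
  have := H k; rewrite sat_imp lip1 implyTb.
  move/(sat_foralls_assign _ _ vw_inj vwE)/(_ (fun _ => w)).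
  move/(sat_foralls_assign _ _ vx_inj (mem_map_iota _ var_x))/(_ x).
  set rho2 := assign vw _ _; have [d2 k2] := keyw w rho1.
  have [d3 k3 m3 w3] := keyx 3 x rho2 isT; set rho3 := assign vx x rho2 in d3 k3 m3 w3 *.
  have w2 : rho2 var_w = w by exact: (assign_in _ _ tt vw_inj).
  have mixed3 : sat rho3 (mixedF g 3 (enum_rank s)) by apply/sat_mixedF; rewrite m3.
  have guar3 : sat rho3 (guaranteeF g 3 (enum_rank s) (Var var_w)).
    by apply/sat_guaranteeF; rewrite m3 k3 k2 k1 /eval /= w3 w2.
  rewrite sat_imp sat_and mixed3 guar3 implyTb.
  move/(sat_exs_assign _ _ vy_inj (mem_map_iota _ var_y)) => [y].
  have [d4 k4 m4 w4] := keyx 4 y rho3 isT; set rho4 := assign vy y rho3 in d4 k4 m4 w4 *.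
  rewrite sat_and => /andP[/sat_mixedF ym /sat_guaranteeF yw].
  rewrite m4 in ym; exists y => // b bA; have := yw b bA.
  rewrite m4 k4 k3 k2 k1 eval_subE /eval /= -/(dval rho4 s' t') d4 d3 d2 d1.
  by rewrite w4 w3 w2.
set rho1 := assign vk k rho; have [d1 k1] := key k rho1 erefl.
rewrite sat_imp; apply/implyP => /sat_lipF; rewrite d1 k1 => kd.
apply/(sat_foralls_assign _ _ vw_inj vwE) => fw; pose w := fw tt.
have -> : fw = (fun _ => w) by apply/funext => -[].
apply/(sat_foralls_assign _ _ vx_inj (mem_map_iota _ var_x)) => x.
set rho2 := assign vw _ _; have [d2 k2] := keyw w rho1.
have [d3 k3 m3 w3] := keyx 3 x rho2 isT; set rho3 := assign vx x rho2 in d3 k3 m3 w3 *.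
have w2 : rho2 var_w = w by exact: (assign_in _ _ tt vw_inj).
rewrite sat_imp sat_and; apply/implyP => /andP[/sat_mixedF xm /sat_guaranteeF wx].
rewrite m3 in xm; rewrite m3 k3 k2 k1 /eval /= w3 w2 in wx.
have [y ym yw] := H k kd w x xm wx.
apply/(sat_exs_assign _ _ vy_inj (mem_map_iota _ var_y)); exists y.
have [d4 k4 m4 w4] := keyx 4 y rho3 isT; set rho4 := assign vy y rho3 in d4 k4 m4 w4 *.
rewrite sat_and; apply/andP; split; first by apply/sat_mixedF; rewrite m4.
apply/sat_guaranteeF => b bA; have := yw b bA.
rewrite m4 k4 k3 k2 k1 eval_subE /eval /= -/(dval rho4 s' t') d4 d3 d2 d1.
by rewrite w4 w3 w2.
Qed.

Lemma sat_obsF rho s t : sat rho (obsF g (enum_rank s) (enum_rank t)) <->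
  forall v, `|obs RG v s - obs RG v t| <= dval rho s t.
Proof.
rewrite sat_conj gO_code.
have atomE v : sat rho (qe_and
    (qe_le (subE (obsE g (enum_rank v) (enum_rank s)) (obsE g (enum_rank v) (enum_rank t)))
       (Var (var_d (enum_rank s) (enum_rank t))))
    (qe_le (subE (obsE g (enum_rank v) (enum_rank t)) (obsE g (enum_rank v) (enum_rank s)))
       (Var (var_d (enum_rank s) (enum_rank t))))) =
    (`|obs RG v s - obs RG v t| <= dval rho s t).
  rewrite sat_and !sat_le !eval_subE !eval_obsE [eval _ (Var _)]/(dval rho s t).
  by rewrite ler_norml andbC lerNl opprB.
split=> [/all_iotaP H v|H]; first by rewrite -atomE; exact: H.
by apply/all_iotaP => v; rewrite atomE.
Qed.

Lemma sat_metricF rho bis : sat rho (metricF g bis) <-> simulation_metric (G := RG) bis (dval rho).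
Proof.
rewrite sat_conj gN_code; split=> [/all_iotaP H|[d0 H]].
  have {}H s t : [/\ 0 <= dval rho s t, forall v, `|obs RG v s - obs RG v t| <= dval rho s t,
     simulates (G := RG) (dval rho) s t (dval rho s t) &
     bis -> simulates (G := RG) (dval rho) s t (dval rho t s)].
    have := H s; rewrite sat_conj => /all_iotaP/(_ t); rewrite !sat_and sat_le eval_zeroE.
    case/and4P => h0 /sat_obsF ho /sat_simulatesF hs hb; split=> // b.
    by move: hb; rewrite b => /sat_simulatesF.
  by split=> [s t|s t]; case: (H s t).
apply/all_iotaP => s; rewrite sat_conj; apply/all_iotaP => t.
have [ho hs hb] := H s t.
rewrite !sat_and sat_le eval_zeroE; apply/and4P; split.
- exact: d0.
- exact/sat_obsF.
- exact/sat_simulatesF.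
- by case: (bis) hb => // hb; apply/sat_simulatesF; exact: hb.
Qed.

Lemma distF_correct bis strict s t c (r : R) : (forall rho, eval rho c = r) ->
  holds0 (distF g bis strict (enum_rank s) (enum_rank t) c) <->
  if strict then game_dist (G := RG) bis s t < r else game_dist (G := RG) bis s t <= r.
Proof.
move=> cE; rewrite -(sat0 R).
pose vd (p : state G * state G) := var_d (enum_rank p.1) (enum_rank p.2).
have vd_inj : injective vd.
  move=> [s1 t1] [s2 t2] /pcons_inj[_ /pcons_inj[]].
  move=> /ord_inj/enum_rank_inj es /ord_inj/enum_rank_inj et.
  by rewrite /= in es et; rewrite es et.
have vdE : var_ds g =i codom vd.
  move=> n; apply/flattenP/codomP.
    case=> l /mapP[i]; rewrite gN_code mem_iota /= => iN ->.
    case/mapP => j; rewrite mem_iota /= => jN ->.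
    by exists (enum_val (Ordinal iN), enum_val (Ordinal jN)); rewrite /vd !enum_valK.
  case=> -[s1 t1] ->.
  exists [seq var_d (enum_rank s1) j | j <- iota 0 (gN g)].
    by apply: (map_f (fun i => [seq var_d i j | j <- iota 0 (gN g)])); rewrite mem_iota gN_code /=.
  by apply: map_f; rewrite mem_iota gN_code /=.
have dvalE rho (d : state RG -> state RG -> R) :
    dval (assign vd (fun p => d p.1 p.2) rho) = d.
  by apply/funext => s1; apply/funext => t1; rewrite /dval (assign_in _ _ (s1, t1) vd_inj).
have cmpE rho : sat rho (if strict then qe_lt (Var (var_d (enum_rank s) (enum_rank t))) c
     else qe_le (Var (var_d (enum_rank s) (enum_rank t))) c) =
   (if strict then dval rho s t < r else dval rho s t <= r).
  by case: strict; rewrite ?sat_lt ?sat_le cE.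
have main : sat (fun _ => 0 : R) (distF g bis strict (enum_rank s) (enum_rank t) c) <->
  exists2 d, simulation_metric (G := RG) bis d & if strict then d s t < r else d s t <= r.
  rewrite (sat_exs_assign _ _ vd_inj vdE); split=> [[f]|[d dm dr]].
    by rewrite sat_and cmpE => /andP[/sat_metricF dm dr]; eexists; [exact: dm|].
  exists (fun p => d p.1 p.2); rewrite sat_and cmpE; apply/andP; split.
    by apply/sat_metricF; rewrite dvalE.
  by rewrite dvalE.
rewrite main; case: strict {cmpE main}.
  by split=> /game_dist_ltP.
by split=> /game_dist_leP.
Qed.

End Correctness.

(** The code holds the value and the tolerance in two entries each, then two ranks, then the game;
    hence the positions 0, 2, 4, 5 and 6. The lower bound on the distance is the negation of a [<=]
    sentence. *)
Definition approx_test (bis : bool) (l : seq nat) : bool :=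
  holds0 (distF (drop 6 l) bis true (nth 0%N l 4) (nth 0%N l 5) (Add (ratE l 0) (ratE l 2))) &&
  ~~ holds0 (distF (drop 6 l) bis false (nth 0%N l 4) (nth 0%N l 5) (subE (ratE l 0) (ratE l 2))).

(** Distances are nonnegative, so being zero is being at most zero. *)
Definition zero_test (bis : bool) (l : seq nat) : bool :=
  holds0 (distF (drop 2 l) bis false (nth 0%N l 0) (nth 0%N l 1) zeroE).

Lemma computable_approx_test bis : computable (approx_test bis).
Proof. by rewrite /approx_test /distF /var_d; computability. Qed.

Lemma computable_zero_test bis : computable (zero_test bis).
Proof. by rewrite /zero_test /distF /var_d; computability. Qed.

Lemma approx_testP (R : realType) bis (q : approx_instance) :
  `|game_dist (G := real_game R (inst_game (approx_inst q))) bis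
     (inst_s (approx_inst q)) (inst_t (approx_inst q)) - ratr (approx_val q)| < ratr (approx_eps q)
  <-> approx_test bis (code_approx_instance q).
Proof.
case: q => -[G s t] v e e0 /=; set l := code_approx_instance _.
have vE rho : eval rho (ratE l 0) = ratr v :> R by exact: eval_ratE.
have eE rho : eval rho (ratE l 2) = ratr e :> R by exact: eval_ratE.
have addE rho : eval rho (Add (ratE l 0) (ratE l 2)) = ratr v + ratr e :> R by rewrite evalD vE eE.
have subE' rho : eval rho (subE (ratE l 0) (ratE l 2)) = ratr v - ratr e :> R.
  by rewrite eval_subE vE eE.
have lt := distF_correct bis true s t addE; have le := distF_correct bis false s t subE'.
set d := game_dist _ _ _ in lt le *.
rewrite /approx_test; have -> : drop 6 l = code_game G by [].
rewrite -[nth 0%N l 4]/(nat_of_ord (enum_rank s)) -[nth 0%N l 5]/(nat_of_ord (enum_rank t)).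
split=> [h|/andP[/lt h1 /negP h2]].
  apply/andP; split; first by apply/lt; move: h; rewrite ltr_norml; lra.
  by apply/negP => /le; move: h; rewrite ltr_norml; lra.
have h3 : ratr v - ratr e < d by rewrite ltNge; apply/negP => /le.
by rewrite ltr_norml; lra.
Qed.

Lemma zero_testP (R : realType) bis (q : instance) :
  game_dist (G := real_game R (inst_game q)) bis (inst_s q) (inst_t q) = 0
  <-> zero_test bis (code_instance q).
Proof.
case: q => G s t /=; set l := code_instance _.
have le := distF_correct bis false s t (@eval_zeroE R).
rewrite /zero_test; have -> : drop 2 l = code_game G by [].
rewrite -[nth 0%N l 0]/(nat_of_ord (enum_rank s)) -[nth 0%N l 1]/(nat_of_ord (enum_rank t)).
rewrite le; split=> [->|d0]; first exact: lexx.
by apply/eqP; rewrite eq_le d0 game_dist_ge0.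
Qed.

Theorem theorem3p17 (R : realType) :
  [/\ decidable_problem code_approx_instance (fun q : approx_instance =>
        `|@sim_dist R (real_game R (inst_game (approx_inst q))) player1
             (inst_s (approx_inst q)) (inst_t (approx_inst q))
          - ratr (approx_val q)| < ratr (approx_eps q)),
      decidable_problem code_approx_instance (fun q : approx_instance =>
        `|@game_bisim_dist R (real_game R (inst_game (approx_inst q)))
             (inst_s (approx_inst q)) (inst_t (approx_inst q))
          - ratr (approx_val q)| < ratr (approx_eps q)),
      decidable_problem code_instance (fun q : instance =>
        @sim R (real_game R (inst_game q)) player1 (inst_s q) (inst_t q))
    & decidable_problem code_instance (fun q : instance =>
        @game_bisim R (real_game R (inst_game q)) (inst_s q) (inst_t q))].
Proof.
split.
- exact: computable_decidable (computable_approx_test false) (approx_testP R false).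
- exact: computable_decidable (computable_approx_test true) (approx_testP R true).
- exact: computable_decidable (computable_zero_test false) (zero_testP R false).
- exact: computable_decidable (computable_zero_test true) (zero_testP R true).
Qed.
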